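(* Let $n\in\mathbb N$. The Poisson bracket on $\mathbb M_n$ given by $$\{\varphi,\psi\}=\left\langle\left\langle\begin{pmatrix} r+\frac12\frac{1+\hat h^n}{1-\hat h^n}P_0' & -\frac{\hat h^n}{1-\hat h^n}P_0'+\frac12P_{00}\\[4pt] \frac{1}{1-\hat h^n}P_0'+\frac12P_{00} & r-\frac12\frac{1+\hat h^n}{1-\hat h^n}P_0'\end{pmatrix}\begin{pmatrix}\nabla\varphi\\ \nabla'\varphi\end{pmatrix},\begin{pmatrix}\nabla\psi\\ \nabla'\psi\end{pmatrix}\right\rangle\right\rangle,\qquad r=\tfrac12(P_+-P_-),$$ coincides with the q-deformed Gelfand-Dickey structure $\{\cdot,\cdot\}_q$ on $\mathbb M_n$ obtained by the q-deformed Drinfeld-Sokolov reduction, i.e. with the bracket $\{\varphi,\psi\}_q(L)=\{\hat\varphi,\hat\psi\}_S(\mathcal L)$.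
   Context: Fix $q\in\mathbb C$, $0<|q|<1$. Scalar side. $\mathbb C((z^{-1}))$ is the field of formal series $\sum_{i\le N}a_iz^i$; $(\hat hf)(z)=f(qz)$. $\Psi\mathbf D_q$ is the algebra of formal series $\sum_{i=-\infty}^{N}a_iD^i$, $a_i\in\mathbb C((z^{-1}))$, with $D a=(\hat ha)D$. $P_+,P_0,P_-$ are the projections onto the parts with positive, zero, negative powers of $D$; $\int a\,dz/z$ is the coefficient of $z^0$; $\operatorname{Tr}A=\int P_0A\,dz/z$; $\langle A,B\rangle=\operatorname{Tr}AB$; $P_{00}A=\operatorname{Tr}(A)\cdot1$, $P_0'=P_0-P_{00}$. $\mathbb M_n$ is the affine space of $L=D^n+u_{n-1}D^{n-1}+\dots+u_0$. For a functional $\varphi$ on $\mathbb M_n$, $d\varphi(L)\in\Psi\mathbf D_q$ is any element with $\langle d\varphi(L),X\rangle=\frac d{dt}|_{t=0}\varphi(L+tX)$ for $X$ tangent to $\mathbb M_n$ (the first bracket does not depend on the choice); $\nabla\varphi=L\,d\varphi$, $\nabla'\varphi=d\varphi\,L$. Throughout, $\langle\langle(X_1,X_2),(Y_1,Y_2)\rangle\rangle=\langle X_1,Y_1\rangle-\langle X_2,Y_2\rangle$ for the relevant inner product. Matrix side. $L\mathfrak{gl}(n)$ is the algebra of $n\times n$ matrices over $\mathbb C((z^{-1}))$ with inner product $\langle A,B\rangle=\int\frac{dz}z\operatorname{Tr}A(z)B(z)$ (matrix trace); $\hat h$ acts entrywise and ${}^hS=\hat hS$. $LN_-(n)$ is the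 group of unipotent lower triangular matrices over $\mathbb C((z^{-1}))$, acting on $L\mathfrak{gl}(n)$ by gauge transformations $\mathcal L\mapsto {}^hS\,\mathcal L\,S^{-1}$. $\mathbb Y_n\subset L\mathfrak{gl}(n)$ is the set of matrices with all entries on the superdiagonal equal to $1$, all entries above it zero, and arbitrary entries on and below the diagonal. It is known that the gauge action on $\mathbb Y_n$ is free and that the companion matrices $$\mathcal L=\begin{pmatrix}0&1&\cdots&0\\ \vdots&\vdots&\ddots&\vdots\\ 0&0&\cdots&1\\ -u_0&-u_1&\cdots&-u_{n-1}\end{pmatrix}$$ form a cross-section, so that $\mathbb Y_n/LN_-(n)\simeq\mathbb M_n$, the operator $L=D^n+u_{n-1}D^{n-1}+\dots+u_0$ corresponding to the companion matrix $\mathcal L$ with last row $(-u_0,-u_1,\dots,-u_{n-1})$; let $\pi:\mathbb Y_n\to\mathbb M_n$ be the projection. Let $\mathcal P_+,\mathcal P_-,\mathcal P_0$ be the projectors of $L\mathfrak{gl}(n)$ onto strictly upper triangular, strictly lower triangular and diagonal matrices; $R_s\operatorname{diag}(\alpha_0,\dots,\alpha_{n-1})=\operatorname{diag}(\alpha_{n-1},\alpha_0,\dots,\alpha_{n-2})$; $\theta=R_s\hat h$; $\mathcal P_0'A=\mathcal P_0A-\frac1n\left(\int\frac{dz}z\operatorname{Tr}A\right)\cdot 1$; $$\hat r=\tfrac12\left(\mathcal P_+-\mathcal P_-+\tfrac{1+\theta}{1-\theta}\mathcal P_0'\right),\qquad \hat r_\pm=\hat r\pm\tfrac12\mathrm{id}.$$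 For a functional $\hat\varphi$ on $L\mathfrak{gl}(n)$, with gradient $d\hat\varphi$ with respect to the inner product, $\nabla\hat\varphi=\mathcal L\,d\hat\varphi$, $\nabla'\hat\varphi=d\hat\varphi\,\mathcal L$. The bracket on $L\mathfrak{gl}(n)$ is $$\{\hat\varphi,\hat\psi\}_S=\left\langle\left\langle\begin{pmatrix}\hat r&-\hat h\hat r_+\\ \hat r_-\hat h^{-1}&-\hat r\end{pmatrix}\begin{pmatrix}\nabla\hat\varphi\\ \nabla'\hat\varphi\end{pmatrix},\begin{pmatrix}\nabla\hat\psi\\ \nabla'\hat\psi\end{pmatrix}\right\rangle\right\rangle .$$ It is known that gauge-invariant functionals form a Poisson subalgebra for $\{\cdot,\cdot\}_S$, and that gauge-invariant functionals vanishing on $\mathbb Y_n$ form a Poisson ideal in it. The q-deformed (second) Gelfand-Dickey structure is the resulting quotient bracket on $\mathbb M_n$: $\{\varphi,\psi\}_q(L)=\{\hat\varphi,\hat\psi\}_S(\mathcal L)$, where $\mathcal L$ is the companion matrix of $L$ and $\hat\varphi,\hat\psi$ are any $LN_-(n)$-invariant functionals on $L\mathfrak{gl}(n)$ with $\hat\varphi|_{\mathbb Y_n}=\pi^*\varphi$, $\hat\psi|_{\mathbb Y_n}=\pi^*\psi$. *)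

(* Defs.v *)
From HB Require Import structures.
From mathcomp Require Import all_boot all_order all_algebra.
From mathcomp Require Import complex zify ring.
From mathcomp Require Import all_classical all_reals all_analysis.

Set Implicit Arguments.
Unset Strict Implicit.
Unset Printing Implicit Defensive.

Import Order.TTheory GRing.Theory Num.Theory.
Import numFieldNormedType.Exports.

Local Open Scope classical_set_scope.
Local Open Scope ring_scope.

(* A formal series sum_(i <= N) a_i X^i is its family of coefficients, indexed
   by int.  Used for C((1/z)) = [laurent C], with X = z, and for the
   pseudodifference operators [qpdo C], with X = D and coefficients in
   [laurent C]. *)

Definition bounded_above (A : zmodType) : {pred int -> A} :=
  [pred a | `[< exists N : int, forall i : int, N < i -> a i = 0 >]].

Lemma bounded_aboveP (A : zmodType) (a : int -> A) :
  reflect (exists N : int, forall i : int, N < i -> a i = 0)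
          (a \in @bounded_above A).
Proof. exact: asboolP. Qed.

Fact bounded_above_zmod_closed (A : zmodType) : zmod_closed (@bounded_above A).
Proof.
split; first by apply/bounded_aboveP; exists 0.
move=> a b /bounded_aboveP[N aN] /bounded_aboveP[M bM].
apply/bounded_aboveP; exists (Order.max N M) => i.
rewrite gt_max => /andP[Ni Mi].
have -> : (a - b) i = a i - b i by [].
by rewrite aN// bM// subr0.
Qed.

HB.instance Definition _ (A : zmodType) :=
  GRing.isZmodClosed.Build (int -> A) (@bounded_above A)
    (bounded_above_zmod_closed A).

Record series (A : zmodType) :=
  Series { coefs :> int -> A; _ : coefs \in @bounded_above A }.

HB.instance Definition _ (A : zmodType) := [isSub for @coefs A].
HB.instance Definition _ (A : zmodType) := [Choice of series A by <:].
HB.instance Definition _ (A : zmodType) :=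
  [SubChoice_isSubZmodule of series A by <:].

Lemma eq_series (A : zmodType) (a b : series A) : a =1 b -> a = b.
Proof. by move=> ab; apply/val_inj/funext. Qed.

Section SeriesTheory.
Variable A : zmodType.
Implicit Types (a b : series A) (f : int -> A).

Lemma series_bound a : exists N : int, forall i : int, N < i -> a i = 0.
Proof. exact/bounded_aboveP/(valP a). Qed.

Lemma coef0 i : (0 : series A) i = 0. Proof. by []. Qed.
Lemma coefD a b i : (a + b) i = a i + b i. Proof. by []. Qed.
Lemma coefN a i : (- a) i = - a i. Proof. by []. Qed.
Lemma coefB a b i : (a - b) i = a i - b i. Proof. by []. Qed.

(* the monomial x X^i *)
Definition mono_fun (i : int) (x : A) : int -> A :=
  fun k => if k == i then x else 0.

Fact mono_bounded i x : mono_fun i x \in @bounded_above A.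
Proof.
apply/bounded_aboveP; exists i => k ik.
by rewrite /mono_fun gt_eqF.
Qed.

Definition mono i x : series A := Series (mono_bounded i x).

(* the part of the series with exponents satisfying P *)
Definition part_fun (P : pred int) a : int -> A :=
  fun k => if P k then a k else 0.

Fact part_bounded P a : part_fun P a \in @bounded_above A.
Proof.
have [N aN] := series_bound a.
by apply/bounded_aboveP; exists N => k Nk; rewrite /part_fun aN// if_same.
Qed.

Definition part P a : series A := Series (part_bounded P a).

(* sum_k a_k X^k |-> sum_k s_k(a_k) X^k *)
Definition smap_fun (B : zmodType) (s : int -> {additive A -> B}) a : int -> B :=
  fun k => s k (a k).

Fact smap_bounded (B : zmodType) (s : int -> {additive A -> B}) a :
  smap_fun s a \in @bounded_above B.
Proof.
have [N aN] := series_bound a.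
by apply/bounded_aboveP; exists N => k Nk; rewrite /smap_fun aN// raddf0.
Qed.

Definition smap (B : zmodType) (s : int -> {additive A -> B}) a : series B :=
  Series (smap_bounded s a).

Fact smap_is_zmod_morphism (B : zmodType) (s : int -> {additive A -> B}) :
  zmod_morphism (smap s).
Proof. by move=> a b; apply: eq_series => i; exact: raddfB. Qed.

HB.instance Definition _ (B : zmodType) (s : int -> {additive A -> B}) :=
  GRing.isZmodMorphism.Build (series A) (series B) (smap s)
    (smap_is_zmod_morphism s).

End SeriesTheory.

Fact bounded_above_submod_closed (C : nzRingType) (A : lmodType C) :
  GRing.scaler_closed (@bounded_above A).
Proof.
move=> c a /bounded_aboveP[N aN]; apply/bounded_aboveP.
by exists N => i /aN ai; have -> : (c *: a) i = c *: a i by []; rewrite ai scaler0.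
Qed.

HB.instance Definition _ (C : nzRingType) (A : lmodType C) :=
  GRing.isScaleClosed.Build C (int -> A) (@bounded_above A)
    (@bounded_above_submod_closed C A).

HB.instance Definition _ (C : nzRingType) (A : lmodType C) :=
  [SubZmodule_isSubLmodule of series A by <:].

Definition zrange (lo hi : int) : seq int :=
  [seq lo + Posz k | k <- iota 0 (absz (Order.max (hi - lo + 1) 0))].

Lemma mem_zrange lo hi i : (i \in zrange lo hi) = (lo <= i <= hi).
Proof.
apply/mapP/idP => [[k]|/andP[loi ihi]].
  by rewrite mem_iota => kn ->; lia.
exists (absz (i - lo)); last by lia.
by rewrite mem_iota; lia.
Qed.

Lemma zrange_uniq lo hi : uniq (zrange lo hi).
Proof. by rewrite map_inj_uniq ?iota_uniq// => i j /addrI[]. Qed.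

Lemma fsum_seq (A : zmodType) (f : int -> A) (r : seq int) : uniq r ->
  (forall i, i \notin r -> f i = 0) ->
  \sum_(i \in [set: int]) f i = \sum_(i <- r) f i.
Proof.
move=> ur fr; rewrite fsbig_supp; apply: fsbig_fwiden => //.
  by move=> i [_ fi]; apply/negP => /negP /fr.
by move=> i [_ nfi]; apply: contrapT => fi; apply: nfi; split.
Qed.

Section TwistedProduct.
Variables (A : nzRingType) (s : int -> {additive A -> A}).
Implicit Types (a b c : series A).

(* the product with (x X^i) (y X^j) = x s_i(y) X^(i+j); the sum over setT is
   finitely supported because a and b are bounded above *)
Definition tmul_fun a b : int -> A :=
  fun k => \sum_(i \in [set: int]) a i * s i (b (k - i)).

Lemma tmul_funE a b k N M lo hi :
  (forall i, N < i -> a i = 0) -> (forall i, M < i -> b i = 0) ->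
  lo <= k - M -> N <= hi ->
  tmul_fun a b k = \sum_(i <- zrange lo hi) a i * s i (b (k - i)).
Proof.
move=> aN bM lok Nhi; apply: fsum_seq; rewrite ?zrange_uniq// => i.
rewrite mem_zrange negb_and -!ltNge => /orP[ilo|ihi].
  by rewrite [b _]bM ?raddf0 ?mulr0//; lia.
by rewrite aN ?mul0r//; lia.
Qed.

Fact tmul_bounded a b : tmul_fun a b \in @bounded_above A.
Proof.
have [N aN] := series_bound a; have [M bM] := series_bound b.
apply/bounded_aboveP; exists (N + M) => k kNM.
rewrite (@tmul_funE _ _ _ N M (k - M) N)// big_seq big1// => i.
by rewrite mem_zrange; lia.
Qed.

Definition tmul a b : series A := Series (tmul_bounded a b).

Lemma tmulE a b k : tmul a b k = \sum_(i \in [set: int]) a i * s i (b (k - i)).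
Proof. by []. Qed.

Lemma tmulDl a b c : tmul (a + b) c = tmul a c + tmul b c.
Proof.
apply: eq_series => k; rewrite coefD.
have [N aN] := series_bound a; have [M bM] := series_bound b.
have [P cP] := series_bound c.
pose hi := Order.max N M.
rewrite /tmul /= (@tmul_funE _ _ _ hi P (k - P) hi)//; last first.
  by move=> i; rewrite gt_max => /andP[Ni Mi]; rewrite coefD aN// bM// addr0.
rewrite (@tmul_funE a _ _ N P (k - P) hi)// ?le_max ?lexx//.
rewrite (@tmul_funE b _ _ M P (k - P) hi)// ?le_max ?lexx ?orbT//.
by rewrite -big_split; apply: eq_bigr => i _; rewrite coefD mulrDl.
Qed.

Lemma tmulDr a b c : tmul a (b + c) = tmul a b + tmul a c.
Proof.
apply: eq_series => k; rewrite coefD.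
have [N aN] := series_bound a; have [M bM] := series_bound b.
have [P cP] := series_bound c.
pose m := Order.max M P.
rewrite /tmul /= (@tmul_funE _ (b + c) _ N m (k - m) N)//; last first.
  by move=> i; rewrite gt_max => /andP[Ni Mi]; rewrite coefD bM// cP// addr0.
have Mm : M <= m by rewrite le_max lexx.
have Pm : P <= m by rewrite le_max lexx orbT.
rewrite (@tmul_funE _ b _ N M (k - m) N)//; last by lia.
rewrite (@tmul_funE _ c _ N P (k - m) N)//; last by lia.
by rewrite -big_split; apply: eq_bigr => i _; rewrite coefD raddfD mulrDr.
Qed.

Hypothesis s0 : forall x, s 0 x = x.
Hypothesis sD : forall i j x, s (i + j) x = s i (s j x).
Hypothesis sM : forall i x y, s i (x * y) = s i x * s i y.
Hypothesis s1 : forall i, s i 1 = 1.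

Lemma tmulA : associative tmul.
Proof.
move=> a b c; apply: eq_series => k.
have [N aN] := series_bound a; have [M bM] := series_bound b.
have [P cP] := series_bound c.
have abNM i : N + M < i -> tmul a b i = 0.
  move=> NMi; rewrite /tmul /= (@tmul_funE _ _ _ N M (i - M) N)//.
  by rewrite big_seq big1// => j; rewrite mem_zrange; lia.
have bcMP i : M + P < i -> tmul b c i = 0.
  move=> MPi; rewrite /tmul /= (@tmul_funE _ _ _ M P (i - P) M)//.
  by rewrite big_seq big1// => j; rewrite mem_zrange; lia.
rewrite [LHS](@tmul_funE _ _ _ N (M + P) (k - P - M) N)//; last by lia.
rewrite [RHS](@tmul_funE _ _ _ (N + M) P (k - P) (N + M))//.
transitivity (\sum_(j <- zrange (k - P - M) N) \sum_(i <- zrange (k - P) (N + M))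
    a j * s j (b (i - j)) * s i (c (k - i))).
  apply: eq_big_seq => j; rewrite mem_zrange => /andP[jlo jhi].
  rewrite tmulE (reindex_fsbigT (fun i => i - j)); last first.
    by exists (fun i => i + j) => i; rewrite ?subrK ?addrK.
  rewrite (@fsum_seq _ _ (zrange (k - P) (N + M))) ?zrange_uniq//; last first.
    move=> i; rewrite mem_zrange negb_and -!ltNge => /orP[ilo|ihi].
      by rewrite cP ?raddf0 ?mulr0//; lia.
    by rewrite bM ?mul0r//; lia.
  rewrite raddf_sum mulr_sumr; apply: eq_bigr => i _.
  rewrite sM -sD mulrA; congr (_ * s _ (c _)); lia.
rewrite exchange_big; apply: eq_big_seq => i /=; rewrite mem_zrange.
move=> /andP[ilo ihi]; rewrite -mulr_suml; congr (_ * _).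
by rewrite [RHS](@tmul_funE _ _ _ N M (k - P - M) N)//; lia.
Qed.

Lemma tmul1l a : tmul (mono 0 1) a = a.
Proof.
apply: eq_series => k; rewrite tmulE (@fsum_seq _ _ [:: 0])//.
  by rewrite big_seq1 /= /mono_fun eqxx mul1r s0 subr0.
by move=> i; rewrite inE /= /mono_fun => /negPf->; rewrite mul0r.
Qed.

Lemma tmul1r a : tmul a (mono 0 1) = a.
Proof.
apply: eq_series => k; rewrite tmulE (@fsum_seq _ _ [:: k])//.
  by rewrite big_seq1 /= /mono_fun subrr eqxx s1 mulr1.
by move=> i; rewrite inE /= /mono_fun subr_eq0 eq_sym => /negPf->;
   rewrite raddf0 mulr0.
Qed.

End TwistedProduct.

(* C((1/z)) *)
Definition laurent (C : fieldType) : Type := series C^o.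

Section Laurent.
Variable C : fieldType.

HB.instance Definition _ := GRing.Lmodule.on (laurent C).

Definition lmul (f g : laurent C) : laurent C :=
  tmul (fun=> idfun : {additive C^o -> C^o}) f g.

Fact lmulA : associative lmul. Proof. exact: tmulA. Qed.

Fact lmulC : commutative lmul.
Proof.
move=> f g; apply: eq_series => k.
rewrite /lmul [LHS]tmulE [RHS]tmulE (reindex_fsbigT (fun i => k - i)).
  by apply: eq_fsbigr => i _; rewrite /= subKr mulrC.
by exists (fun i => k - i) => i; rewrite subKr.
Qed.

Fact lmul1l : left_id (mono 0 1 : laurent C) lmul.
Proof. by move=> f; exact: tmul1l. Qed.

Fact lmulDl : left_distributive lmul +%R.
Proof. by move=> f g k; exact: tmulDl. Qed.

Fact laurent1_neq0 : (mono 0 1 : laurent C) != 0.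
Proof.
apply/eqP => /(congr1 (fun f : laurent C => f 0)) /eqP.
by rewrite /= /mono_fun eqxx oner_eq0.
Qed.

HB.instance Definition _ := GRing.Zmodule_isComNzRing.Build (laurent C)
  lmulA lmulC lmul1l lmulDl laurent1_neq0.

(* C((1/z)) is a field, but only the existence of the total inverse operation
   is needed to write [invmx]. *)
Definition lunit : {pred laurent C} := fun f => `[< exists g, g * f = 1 >].
Definition linv (f : laurent C) : laurent C := xget f [set g | g * f = 1].

Fact lmulVx : {in lunit, left_inverse 1 linv *%R}.
Proof. by move=> f /asboolP fU; rewrite /linv; case: xgetP => [g _ //|/forallNP]. Qed.

Fact lunitPl (f g : laurent C) : g * f = 1 -> lunit f.
Proof. by move=> gf; apply/asboolP; exists g. Qed.

Fact linv_out : {in [predC lunit], linv =1 id}.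
Proof.
move=> f /asboolP fU; rewrite /linv; case: xgetP => // g _ gf.
by case: fU; exists g.
Qed.

HB.instance Definition _ := GRing.ComNzRing_hasMulInverse.Build (laurent C)
  lmulVx lunitPl linv_out.

End Laurent.

(* [inv_on U f b] is the a in U with f a = b, i.e. the inverse of f : U -> U
   applied to b; junk value 0 if there is none. *)
Definition inv_on (V : zmodType) (U : set V) (f : V -> V) (b : V) : V :=
  xget 0 [set a | U a /\ f a = b].

Section Scalar.
Variables (C : fieldType) (q : C).
Implicit Types (f : laurent C) (m : int).

Definition lcst (c : C) : laurent C := mono 0 c.

(* the coefficient of z^0, written \int f dz/z *)
Definition residue f : C := f 0.

(* hhat^m f = f (q^m z); for m < 0 this uses q != 0 *)
Definition hpow m f : laurent C :=
  smap (fun k : int => *:%R (q ^ (m * k)) : {additive C^o -> C^o}) f.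

HB.instance Definition _ m := GRing.Additive.copy (hpow m)
  (smap (fun k : int => *:%R (q ^ (m * k)) : {additive C^o -> C^o})).

Definition qpdo : Type := series (laurent C).

Implicit Types A B X Y : qpdo.

(* the product determined by D f = (hhat f) D *)
Definition qmul A B : qpdo :=
  tmul (fun i : int => hpow i : {additive laurent C -> laurent C}) A B.

Definition qcst (c : C) : qpdo := mono 0 (lcst c).

(* hhat^m acting on the coefficients *)
Definition hpow_qpdo m A : qpdo :=
  smap (fun=> hpow m : {additive laurent C -> laurent C}) A.

Definition Ppos A : qpdo := part (fun i => 0 < i) A.
Definition Pzero A : qpdo := part (fun i => i == 0) A.
Definition Pneg A : qpdo := part (fun i => i < 0) A.

Definition qTr A : C := residue (Pzero A 0).

Definition qpair A B : C := qTr (qmul A B).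

Definition P00 A : qpdo := qcst (qTr A).
Definition Pzero' A : qpdo := Pzero A - P00 A.

Definition r_scalar A : qpdo := 2^-1 *: (Ppos A - Pneg A).

(* (1 - hhat^n)^-1 P_0', the inverse being taken on the image of P_0' *)
Definition inv_1mh (n : nat) A : qpdo :=
  inv_on (range Pzero') (fun B => B - hpow_qpdo n B) (Pzero' A).

Definition GD11 (n : nat) X : qpdo :=
  r_scalar X + 2^-1 *: (inv_1mh n X + hpow_qpdo n (inv_1mh n X)).
Definition GD12 (n : nat) X : qpdo :=
  - hpow_qpdo n (inv_1mh n X) + 2^-1 *: P00 X.
Definition GD21 (n : nat) X : qpdo :=
  inv_1mh n X + 2^-1 *: P00 X.
Definition GD22 (n : nat) X : qpdo :=
  r_scalar X - 2^-1 *: (inv_1mh n X + hpow_qpdo n (inv_1mh n X)).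

(* The point u = (u_0, ..., u_(n-1)) stands for the operator
   L = D^n + u_(n-1) D^(n-1) + ... + u_0 of M_n. *)
Definition low_op n (u : 'rV[laurent C]_n) : qpdo :=
  \sum_(i < n) mono (Posz i) (u 0 i).
Definition monic_op n (u : 'rV[laurent C]_n) : qpdo :=
  mono (Posz n) 1 + low_op u.

(* the value at u of the bracket of functionals with differentials dphi, dpsi *)
Definition GD_bracket n (u : 'rV[laurent C]_n) (dphi dpsi : qpdo) : C :=
  let L := monic_op u in
  let X1 := qmul L dphi in let X2 := qmul dphi L in
  let Y1 := qmul L dpsi in let Y2 := qmul dpsi L in
  qpair (GD11 n X1 + GD12 n X2) Y1 - qpair (GD21 n X1 + GD22 n X2) Y2.

End Scalar.

Section Matrix.
Variables (C : fieldType) (q : C) (n : nat).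
Local Notation LM := 'M[laurent C]_n.
Implicit Types A B S X Y : LM.

Definition mxint A : C := residue (\tr A).

Definition mxpair A B : C := mxint (A *m B).

Definition mxhpow (m : int) A : LM := map_mx (hpow q m) A.

Definition mxPpos A : LM := \matrix_(i, j) if (i < j)%N then A i j else 0.
Definition mxPneg A : LM := \matrix_(i, j) if (j < i)%N then A i j else 0.
Definition mxPzero A : LM := \matrix_(i, j) if i == j then A i j else 0.
Definition mxPzero' A : LM := mxPzero A - (lcst (n%:R^-1 * mxint A))%:M.

(* R_s diag(a_0, ..., a_(n-1)) = diag(a_(n-1), a_0, ..., a_(n-2)) *)
Definition mxRs A : LM :=
  \matrix_(i, j) if i == j then A (ord_pred i) (ord_pred i) else 0.
Definition theta A : LM := mxRs (mxhpow 1 A).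

(* ((1 + theta) / (1 - theta)) P_0', the inverse being taken on the image
   of P_0' *)
Definition cayley A : LM :=
  let B := inv_on (range mxPzero') (fun B => B - theta B) (mxPzero' A) in
  B + theta B.

Definition rhat A : LM := lcst 2^-1 *: (mxPpos A - mxPneg A + cayley A).
Definition rhat_plus A : LM := rhat A + lcst 2^-1 *: A.
Definition rhat_minus A : LM := rhat A - lcst 2^-1 *: A.

(* the value at A of {.,.}_S on functionals with gradients dphi, dpsi *)
Definition S_bracket A (dphi dpsi : LM) : C :=
  let X1 := A *m dphi in let X2 := dphi *m A in
  let Y1 := A *m dpsi in let Y2 := dpsi *m A in
  mxpair (rhat X1 - mxhpow 1 (rhat_plus X2)) Y1
  - mxpair (rhat_minus (mxhpow (- 1) X1) - rhat X2) Y2.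

Definition LNminus : set LM :=
  [set S : LM | forall i j : 'I_n, (i = j -> S i j = 1) /\ ((i < j)%N -> S i j = 0)].

Definition gauge S A : LM := mxhpow 1 S *m A *m invmx S.

Definition Yn : set LM :=
  [set A : LM | forall i j : 'I_n, (j = i.+1 :> nat -> A i j = 1) /\
                              ((i.+1 < j)%N -> A i j = 0)].

Definition companion (u : 'rV[laurent C]_n) : LM :=
  \matrix_(i, j) if i.+1 == n then - u 0 j else (j == i.+1 :> nat)%:R.

(* pi A = u: the gauge orbit of A meets the cross-section at companion u *)
Definition pi_rel A (u : 'rV[laurent C]_n) : Prop :=
  Yn A /\ exists2 S, LNminus S & gauge S A = companion u.

End Matrix.

Section Functionals.
Variables (C : numFieldType) (q : C).

(* d/dt f (A + t X) at t = 0 exists and equals l; t ranges over C *)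
Definition has_dderiv m n (f : 'M[laurent C]_(m, n) -> C)
    (A X : 'M[laurent C]_(m, n)) (l : C) : Prop :=
  is_derive (0 : C^o) 1 (fun t : C^o => f (A + lcst t *: X) : C^o) l.

(* The restriction of f to every finite-dimensional affine subspace is
   complex differentiable; no topology on the infinite-dimensional space is
   involved.  By Hartogs' theorem this already follows from the existence of
   the directional derivatives [has_dderiv] in all directions at all points. *)
Definition fin_differentiable m n (f : 'M[laurent C]_(m, n) -> C) : Prop :=
  forall (A : 'M[laurent C]_(m, n)) (k : nat) (X : 'I_k -> 'M[laurent C]_(m, n)),
  differentiable
    (fun s : 'rV[C]_k => f (A + \sum_(i < k) lcst (s 0 i) *: X i) : C^o)
    (0 : 'rV[C]_k).

Definition is_differential n (phi : 'rV[laurent C]_n -> C)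
    (u : 'rV[laurent C]_n) (dphi : qpdo C) : Prop :=
  forall x, has_dderiv phi u x (qpair q dphi (low_op x)).

Definition is_gradient n (f : 'M[laurent C]_n -> C) (A df : 'M[laurent C]_n) :
  Prop := forall X, has_dderiv f A X (mxpair df X).

Definition functional_M n (phi : 'rV[laurent C]_n -> C) : Prop :=
  fin_differentiable phi /\ forall u, exists d, is_differential phi u d.

Definition functional_gl n (f : 'M[laurent C]_n -> C) : Prop :=
  fin_differentiable f /\ forall A, exists d, is_gradient f A d.

(* f is an LN_- (n)-invariant functional restricting to pi^* phi on Y_n *)
Definition is_lift n (phi : 'rV[laurent C]_n -> C) (f : 'M[laurent C]_n -> C) :
  Prop :=
  [/\ functional_gl f,
      forall S A, LNminus S -> f (gauge q S A) = f A &
      forall A u, pi_rel q A u -> f A = phi u].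

(* {phi, psi}_q (u) is defined and equals c: invariant lifts exist and all of
   them give the value c *)
Definition is_qGD_bracket n (phi psi : 'rV[laurent C]_n -> C)
    (u : 'rV[laurent C]_n) (c : C) : Prop :=
  [/\ exists f, is_lift phi f,
      exists g, is_lift psi g &
      forall f g df dg, is_lift phi f -> is_lift psi g ->
        is_gradient f (companion u) df -> is_gradient g (companion u) dg ->
        S_bracket q (companion u) df dg = c].

End Functionals.

(* Main.v *)
From HB Require Import structures.
Require Import Defs.
From mathcomp Require Import all_boot all_order all_algebra.
From mathcomp Require Import complex zify ring.
From mathcomp Require Import all_classical all_reals all_analysis.

(** Why the two brackets agree. Write h for the dilation [hpow q 1], A for the
    companion matrix of L = [monic_op u], and <,> for the residue pairings.

    Invariant lifts exist. The rows v_0 = (1, 0, ..., 0), v_(k+1) = h(v_k) A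
    become v_k S^-1 when A is gauge transformed by a lower unipotent S. Hence
    the determinants [coeff_inv], obtained from (v_0, ..., v_(n-1)) by replacing
    one row by v_n, are invariant; at a companion matrix they give back the
    coefficients u_j. They are polynomials in the entries and their dilates, so
    composing a functional with them gives a functional on all matrices
    ([lift_exists]).

    The matrix bracket is a skew form. For the gradient df of a lift at A put
    X1 = h^-1 (A df) and X2 = df A. Invariance says that X1 - X2 is lower
    triangular ([lift_gradient_gauge]). As the r-matrix commutes with h, the
    bracket is half of <cayley (X1 - X2), Y1 - Y2> + <X1, Y2> - <X2, Y1>
    ([S_bracketE]), and the Cayley transform of theta can be expressed by
    arbitrary solutions of B - theta B = P_0 (X1 - X2) ([mxpair_cayley]).
    Invariance and the last column of df, which is the differential of the
    functional, determine df on and above the diagonal ([lift_gradient_upper]);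
    what remains is strictly lower triangular and lies in the kernel of the form
    ([reduced_form_strictly_lower]).

    The scalar bracket is a similar form. Using cyclicity of the trace it becomes
    <(L X)_(>= 0), L Y> - <(X L)_(>= 0), Y L>
      + <h^n be, (L Y)_0> - <be, (Y L)_0>
    with be - h^n be = (L X)_0 - (X L)_0 ([GD_bracketE]). It is unaffected by
    coefficients of X and Y outside degrees - (n - 1), ..., 0
    ([GD_form_far_l], [GD_form_far_r]), so X = sum_j D^-j xi_j may be assumed.

    The two forms meet at the canonical gradient
    df_(i,j) = - sum_k h^-k (xi_(i+k) u_(j+1+k)). For it X1 and X2 coincide
    except that X1 has an additional last row and X2 an additional first column,
    whose entries are dilates of coefficients of (L X)_(<= 0) L and of X L.
    Pairing them yields the traces above, and the diagonal solution is built
    from h^i be ([reduced_form_canonical]). *)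

Set Implicit Arguments.
Unset Strict Implicit.
Unset Printing Implicit Defensive.

Import Order.TTheory GRing.Theory Num.Theory.
Import numFieldNormedType.Exports.

Local Open Scope classical_set_scope.
Local Open Scope ring_scope.

(** * Formal Laurent series and the dilation *)

Arguments residue : simpl never.
Arguments hpow : simpl never.
Arguments lcst : simpl never.
Arguments qmul : simpl never.

Section LaurentTheory.
Variable C : fieldType.
Implicit Types (f g : laurent C) (c : C).

Lemma lcoefB f g k : (f - g) k = f k - g k. Proof. by []. Qed.

Lemma coef_mul f g k : (f * g) k = \sum_(i \in [set: int]) f i * g (k - i).
Proof. by []. Qed.

Lemma coef_lcstM c f k : (lcst c * f) k = c * f k.
Proof.
rewrite coef_mul (@fsum_seq _ _ [:: 0])// ?big_seq1 /= /mono_fun ?eqxx ?subr0//.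
by move=> i; rewrite inE => /negPf->; rewrite mul0r.
Qed.

Lemma coef_lcst c k : lcst c k = if k == 0 then c else 0.
Proof. by []. Qed.

Fact lcst_is_zmod_morphism : zmod_morphism (@lcst C).
Proof.
move=> c d; apply: eq_series => k; rewrite lcoefB !coef_lcst.
by case: ifP; rewrite ?subr0.
Qed.
Fact lcst_is_monoid_morphism : monoid_morphism (@lcst C).
Proof.
split=> // c d; apply: eq_series => k; rewrite coef_lcstM !coef_lcst.
by case: ifP; rewrite ?mulr0.
Qed.
HB.instance Definition _ := GRing.isZmodMorphism.Build C (laurent C) (@lcst C)
  lcst_is_zmod_morphism.
HB.instance Definition _ := GRing.isMonoidMorphism.Build C (laurent C) (@lcst C)
  lcst_is_monoid_morphism.

Fact residue_is_zmod_morphism : zmod_morphism (@residue C).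
Proof. by []. Qed.
HB.instance Definition _ := GRing.isZmodMorphism.Build (laurent C) C (@residue C)
  residue_is_zmod_morphism.

Lemma residueD f g : residue (f + g) = residue f + residue g. Proof. by []. Qed.
Lemma residueN f : residue (- f) = - residue f. Proof. by []. Qed.

Lemma residue_lcst c : residue (lcst c) = c.
Proof. by []. Qed.

Lemma residue_lcstM c f : residue (lcst c * f) = c * residue f.
Proof. exact: coef_lcstM. Qed.

Lemma residue_mono f k : residue (f * mono (- k) 1) = f k.
Proof.
rewrite /residue coef_mul (@fsum_seq _ _ [:: k])//.
  by rewrite big_seq1 sub0r /= /mono_fun eqxx mulr1.
move=> i; rewrite inE => /negPf ik; rewrite sub0r /= /mono_fun eqr_opp ik.
by rewrite mulr0.
Qed.

(** The residue pairing is nondegenerate: multiplying by a monomial brings any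
    coefficient to degree 0. *)
Lemma residue_eq0 f : (forall x, residue (f * x) = 0) -> f = 0.
Proof.
by move=> f0; apply: eq_series => k; rewrite -residue_mono f0.
Qed.

Variable q : C.
Hypothesis q0 : q != 0.

Lemma coef_hpow m f k : hpow q m f k = q ^ (m * k) * f k.
Proof. by []. Qed.

Lemma hpowM m f g : hpow q m (f * g) = hpow q m f * hpow q m g.
Proof.
apply: eq_series => k; rewrite coef_hpow !coef_mul.
have [N fN] := series_bound f; have [M gM] := series_bound g.
have fE (F : int -> C) : (forall i, f i = 0 -> F i = 0) ->
    (forall i, g (k - i) = 0 -> F i = 0) ->
    \sum_(i \in [set: int]) F i = \sum_(i <- zrange (k - M) N) F i.
  move=> F1 F2; apply: fsum_seq; rewrite ?zrange_uniq// => i.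
  rewrite mem_zrange negb_and -!ltNge => /orP[ilo|ihi].
    by apply/F2/gM; lia.
  exact/F1/fN.
rewrite !fE; do ?by move=> i; rewrite ?coef_hpow => ->; rewrite ?mulr0 ?mul0r.
rewrite mulr_sumr; apply: eq_bigr => i _; rewrite !coef_hpow.
rewrite mulrACA -expfzDr//; congr (q ^ _ * _); lia.
Qed.

Lemma hpowN m f : hpow q m (- f) = - hpow q m f.
Proof. exact: raddfN. Qed.

Lemma hpow0 f : hpow q 0 f = f.
Proof. by apply: eq_series => k; rewrite coef_hpow mul0r mul1r. Qed.

Lemma hpowD m n f : hpow q m (hpow q n f) = hpow q (m + n) f.
Proof.
by apply: eq_series => k; rewrite !coef_hpow mulrA -expfzDr// -mulrDl.
Qed.

Lemma hpowK m f : hpow q (- m) (hpow q m f) = f.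
Proof. by rewrite hpowD addNr hpow0. Qed.
Lemma hpowVK m f : hpow q m (hpow q (- m) f) = f.
Proof. by rewrite hpowD addrN hpow0. Qed.

Lemma hpow_lcst m c : hpow q m (lcst c) = lcst c.
Proof.
apply: eq_series => k; rewrite coef_hpow !coef_lcst.
by case: eqP => [->|_]; rewrite ?mulr0 ?mul1r.
Qed.

Lemma hpow1 m : hpow q m 1 = 1.
Proof. exact: (hpow_lcst m 1). Qed.

Lemma residue_hpow m f : residue (hpow q m f) = residue f.
Proof. by rewrite /residue coef_hpow mulr0 mul1r. Qed.

End LaurentTheory.

(** * Finite-rank differentiable families and the chain rule *)

Section FiniteRank.
Variables (C : numFieldType) (V : normedModType C).

(** Functionals are differentiable only along finite-dimensional affine
    subspaces, so a chain rule is available for families [F] that move in a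
    finite-dimensional space with differentiable coordinates; [dF] is the
    differential of [F] at 0. *)
Definition finrank_diff (W : lmodType (laurent C)) (F dF : V -> W) : Prop :=
  exists (I : finType) (g dg : I -> V -> C^o) (Y : I -> W),
    [/\ forall s, F s = \sum_i lcst (g i s) *: Y i,
        forall v, dF v = \sum_i lcst (dg i v) *: Y i
      & forall i, is_diff (0 : V) (g i) (dg i)].

Variable W : lmodType (laurent C).
Implicit Types (F dF : V -> W).

Lemma finrank_diff_ext F F' dF dF' :
  F =1 F' -> dF =1 dF' -> finrank_diff F dF -> finrank_diff F' dF'.
Proof.
move=> FF' dFF' [I [g [dg [Y [gE dgE gd]]]]].
by exists I, g, dg, Y; split=> // s; rewrite -?FF' -?dFF'.
Qed.

Lemma finrank_diff_term (g dg : V -> C^o) (w : W) : is_diff (0 : V) g dg ->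
  finrank_diff (fun s => lcst (g s) *: w) (fun v => lcst (dg v) *: w).
Proof.
move=> gd; exists unit, (fun=> g), (fun=> dg), (fun=> w).
by split=> // s; rewrite big_const card_unit /= addr0.
Qed.

Lemma finrank_diff_cst (w : W) : finrank_diff (fun=> w) (fun=> 0).
Proof.
apply: finrank_diff_ext (finrank_diff_term w (is_diff_cst (1 : C^o) 0)) => s.
  by rewrite [lcst _]rmorph1 scale1r.
by rewrite [lcst _]rmorph0 scale0r.
Qed.

Lemma finrank_diffD F1 dF1 F2 dF2 : finrank_diff F1 dF1 -> finrank_diff F2 dF2 ->
  finrank_diff (fun s => F1 s + F2 s) (fun v => dF1 v + dF2 v).
Proof.
move=> [I [g [dg [Y [gE dgE gd]]]]] [J [g' [dg' [Y' [gE' dgE' gd']]]]].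
exists (I + J)%type.
exists (fun k => match k with inl i => g i | inr j => g' j end).
exists (fun k => match k with inl i => dg i | inr j => dg' j end).
exists (fun k => match k with inl i => Y i | inr j => Y' j end).
split; last by case.
  by move=> s; rewrite big_sumType /= gE gE'.
by move=> v; rewrite big_sumType /= dgE dgE'.
Qed.

Lemma finrank_diff_sum (I : Type) (r : seq I) (F dF : I -> V -> W) :
  (forall i, finrank_diff (F i) (dF i)) ->
  finrank_diff (fun s => \sum_(i <- r) F i s) (fun v => \sum_(i <- r) dF i v).
Proof.
move=> FdF; elim: r => [|i r IHr].
  by apply: finrank_diff_ext (finrank_diff_cst 0) => s; rewrite big_nil.
by apply: finrank_diff_ext (finrank_diffD (FdF i) IHr) => s; rewrite big_cons.
Qed.

End FiniteRank.

Section FiniteRankMaps.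
Variables (C : numFieldType) (V : normedModType C).

Lemma finrank_diff_map (W W' : lmodType (laurent C)) (T : {additive W -> W'})
    (F dF : V -> W) :
  (forall c w, T (lcst c *: w) = lcst c *: T w) ->
  finrank_diff F dF -> finrank_diff (T \o F) (T \o dF).
Proof.
move=> TZ [I [g [dg [Y [gE dgE gd]]]]].
exists I, g, dg, (fun i => T (Y i)).
split=> // s /=; rewrite ?gE ?dgE raddf_sum.
  by apply: eq_bigr => i _; rewrite TZ.
by apply: eq_bigr => i _; rewrite TZ.
Qed.

Notation finrank_fun := (@finrank_diff C V (laurent C)^o).

Lemma finrank_diffM F1 dF1 F2 dF2 : finrank_fun F1 dF1 -> finrank_fun F2 dF2 ->
  finrank_fun (fun s => F1 s * F2 s : laurent C)
      (fun v => F1 0 * dF2 v + dF1 v * F2 0 : laurent C).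
Proof.
move=> [I [g [dg [Y [gE dgE gd]]]]] [J [g' [dg' [Y' [gE' dgE' gd']]]]].
exists (I * J)%type.
exists (fun k => g k.1 * g' k.2).
exists (fun k => g k.1 0 *: dg' k.2 + g' k.2 0 *: dg k.1).
exists (fun k => Y k.1 * Y' k.2 : laurent C).
split; last by case=> i j; exact: is_diffM.
  move=> s; rewrite gE gE' mulr_suml.
  under eq_bigr do rewrite mulr_sumr.
  rewrite pair_bigA; apply: eq_bigr => -[i j] _ /=.
  by rewrite [lcst (_ * _)]rmorphM [LHS]mulrACA.
move=> v; rewrite dgE dgE' gE gE' !mulr_suml -big_split.
under eq_bigr do rewrite !mulr_sumr -big_split.
rewrite pair_bigA; apply: eq_bigr => -[i j] _ /=.
have -> : lcst ((g i 0 *: dg' j + g' j 0 *: dg i) v) =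
    lcst (g i 0) * lcst (dg' j v) + lcst (g' j 0) * lcst (dg i v).
  by rewrite -!rmorphM -rmorphD.
rewrite [RHS]mulrDl; congr (_ + _); first by rewrite [LHS]mulrACA.
by rewrite [lcst (g' j 0) * _]mulrC [LHS]mulrACA.
Qed.

End FiniteRankMaps.

Section Chain.
Variables (C : numFieldType) (V : normedModType C).

Lemma is_diff_row k (g dg : 'I_k -> V -> C^o) :
  (forall i, is_diff (0 : V) (g i) (dg i)) ->
  is_diff (0 : V) (fun s => \row_i g i s) (fun v => \row_i dg i v).
Proof.
move=> gd.
have rowE (F : 'I_k -> V -> C^o) :
    (fun s => \row_i F i s) = \sum_(i < k) (fun s => F i s *: delta_mx 0 i : 'rV[C]_k).
  apply/funext => s; rewrite fct_sumE [LHS]row_sum_delta.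
  by apply: eq_bigr => i _; rewrite mxE.
rewrite !rowE.
apply: (@big_ind2 _ _ (fun F dF : V -> 'rV[C]_k => is_diff (0 : V) F dF))
  => [|F1 F2 F3 F4 d1 d2|i _].
- exact: is_diff_cst.
- exact: is_diffD.
- have gi := gd i; apply: DiffDef.
    exact: differentiableZl.
  by rewrite diffZl// diff_val.
Qed.

(** [F] is the affine slice through [F 0] spanned by the [Y i], composed with
    its coordinates minus their values at 0. On the slice [f] is differentiable
    by assumption, and its differential there is read off from the directional
    derivatives [l]. *)
Lemma chain_rule m n (f : 'M[laurent C]_(m, n) -> C) (l : 'M[laurent C]_(m, n) -> C)
    (F dF : V -> 'M[laurent C]_(m, n)) :
  fin_differentiable f -> (forall X, has_dderiv f (F 0) X (l X)) ->
  finrank_diff F dF -> is_diff (0 : V) (f \o F : V -> C^o) (l \o dF).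
Proof.
move=> fd fl [I [g [dg [Y [gE dgE gd]]]]].
pose k := #|I|.
pose G i : V -> C^o := g i - cst (g i 0).
have Gd i : is_diff (0 : V) (G i) (dg i).
  by apply: is_diff_eq; rewrite subr0.
pose X (i : 'I_k) := Y (enum_val i).
pose gam (s : V) : 'rV[C]_k := \row_i G (enum_val i) s.
pose dgam (s : V) : 'rV[C]_k := \row_i dg (enum_val i) s.
have gamd : is_diff (0 : V) gam dgam by exact: is_diff_row.
pose sl (r : 'rV[C]_k) : C^o := f (F 0 + \sum_(i < k) lcst (r 0 i) *: X i).
have sumX (h : I -> C) :
    \sum_(i < k) lcst (h (enum_val i)) *: X i = \sum_i lcst (h i) *: Y i.
  rewrite [RHS](reindex (@enum_val I I)) /=; last first.
    by apply: onW_bij; exact: enum_val_bij.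
  by [].
have slE : f \o F = sl \o gam.
  apply/funext => s /=; congr f; under eq_bigr do rewrite mxE.
  rewrite (sumX (G^~ s)) gE (gE 0) -big_split /=.
  by apply: eq_bigr => i _; rewrite -scalerDl -rmorphD subrKC.
have sld : differentiable sl (0 : 'rV[C]_k) by exact: fd.
have dslE r : 'd sl 0 r = l (\sum_(i < k) lcst (r 0 i) *: X i).
  rewrite -deriveE//; have := fl (\sum_(i < k) lcst (r 0 i) *: X i).
  move=> [_ <-]; rewrite /derive; congr (lim (_ @ 0^')).
  apply/funext => t /=; congr (_ *: (_ - _)).
    rewrite /sl; congr (f (_ + _)); rewrite scaler_sumr; apply: eq_bigr => i _.
    by rewrite addr0 mxE scalerA -rmorphM /= addr0 [t *: 1]mulr1.
  rewrite /sl; congr (f (_ + _)); rewrite rmorph0 scale0r.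
  by rewrite big1// => i _; rewrite mxE rmorph0 scale0r.
rewrite slE.
have gam0 : gam 0 = 0 by apply/rowP => i; rewrite !mxE; exact: subrr.
have sld' : is_diff (gam 0) sl ('d sl 0) by rewrite gam0; exact: differentiableP.
have -> : l \o dF = 'd sl 0 \o dgam.
  apply/funext => v /=; rewrite dslE dgE -(sumX (dg^~ v)).
  congr (l _).
  by apply: eq_bigr => i _; rewrite mxE.
exact: is_diff_comp.
Qed.

End Chain.

Lemma has_dderiv_chain (C : numFieldType) m n (f l : 'M[laurent C]_(m, n) -> C)
    (F dF : C^o -> 'M[laurent C]_(m, n)) :
  fin_differentiable f -> (forall X, has_dderiv f (F 0) X (l X)) ->
  finrank_diff F dF -> is_derive (0 : C^o) 1 (f \o F : C^o -> C^o) (l (dF 1)).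
Proof.
move=> fd fl FdF; have cd := chain_rule fd fl FdF.
apply: DeriveDef; first exact: diff_derivable.
by rewrite deriveE// diff_val.
Qed.

(** * Algebra of q-pseudodifference operators *)

Section QpdoTheory.
Variables (C : fieldType) (q : C).
Hypothesis q0 : q != 0.
Implicit Types (A B X Y : qpdo C).

Lemma scale_laurent c (f : laurent C) : c *: f = lcst c * f.
Proof. by apply: eq_series => k; rewrite coef_lcstM. Qed.

Lemma qcoefD A B k : (A + B) k = A k + B k. Proof. by []. Qed.
Lemma qcoefB A B k : (A - B) k = A k - B k. Proof. by []. Qed.
Lemma qcoefZ c A k : (c *: A) k = lcst c * A k.
Proof. by rewrite -scale_laurent. Qed.
Lemma coef_part (P : pred int) A k : part P A k = if P k then A k else 0.
Proof. by []. Qed.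

Lemma coef_mono (V : zmodType) (i : int) (x : V) k :
  mono i x k = if k == i then x else 0.
Proof. by []. Qed.
Lemma coef_hpow_qpdo m A k : hpow_qpdo q m A k = hpow q m (A k).
Proof. by []. Qed.

Lemma qcoef_sum (I : Type) (r : seq I) (F : I -> qpdo C) k :
  (\sum_(i <- r) F i) k = \sum_(i <- r) F i k.
Proof. by elim/big_rec2: _ => // i x y _ <-. Qed.

Lemma coef_qmul A B k (r : seq int) : uniq r ->
  (forall i, i \notin r -> A i * hpow q i (B (k - i)) = 0) ->
  qmul q A B k = \sum_(i <- r) A i * hpow q i (B (k - i)).
Proof. exact: fsum_seq. Qed.

Lemma qmulA : associative (qmul q).
Proof.
apply: tmulA => [i j x|i x y] /=; first by rewrite hpowD.
exact: hpowM.
Qed.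

Lemma qmulDl A B X : qmul q (A + B) X = qmul q A X + qmul q B X.
Proof. exact: tmulDl. Qed.
Lemma qmulDr A B X : qmul q X (A + B) = qmul q X A + qmul q X B.
Proof. exact: tmulDr. Qed.

Lemma qpair_seq A B (r : seq int) : uniq r ->
  (forall i, i \notin r -> A i * hpow q i (B (- i)) = 0) ->
  qpair q A B = \sum_(i <- r) residue (A i * hpow q i (B (- i))).
Proof.
move=> ur AB; rewrite /qpair /qTr /Pzero coef_part eqxx (coef_qmul ur).
  by rewrite raddf_sum; apply: eq_bigr => i _; rewrite sub0r.
by move=> i; rewrite sub0r; exact: AB.
Qed.

Lemma qpair_bounded A B : exists n : nat, forall m, (n <= m)%N ->
  qpair q A B =
    \sum_(i <- zrange (- m%:Z) m) residue (A i * hpow q i (B (- i))).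
Proof.
have [N AN] := series_bound A; have [M BM] := series_bound B.
exists (absz N + absz M)%N => m nm; apply: qpair_seq; first exact: zrange_uniq.
move=> i; rewrite mem_zrange negb_and -!ltNge => /orP[ilo|ihi].
  by rewrite BM ?raddf0 ?mulr0//; lia.
by rewrite AN ?mul0r//; lia.
Qed.

Lemma qpairDl A B X : qpair q (A + B) X = qpair q A X + qpair q B X.
Proof. by rewrite /qpair qmulDl. Qed.
Lemma qpairDr A B X : qpair q X (A + B) = qpair q X A + qpair q X B.
Proof. by rewrite /qpair qmulDr. Qed.

(** The trace property: the term of index i on one side is the dilate by
    hhat^i of the term of index - i on the other. *)
Lemma qpairC A B : qpair q A B = qpair q B A.
Proof.
have [n1 E1] := qpair_bounded A B; have [n2 E2] := qpair_bounded B A.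
rewrite (E1 (maxn n1 n2)) ?leq_maxl// (E2 (maxn n1 n2)) ?leq_maxr//.
set m := maxn _ _.
rewrite [RHS](perm_big [seq - i | i <- zrange (- m%:Z) m]).
  rewrite [RHS]big_map; apply: eq_bigr => i _; rewrite opprK.
  rewrite -(residue_hpow q i (B (- i) * _)) hpowM// hpowVK//.
  by rewrite mulrC.
apply: uniq_perm; rewrite ?(map_inj_uniq oppr_inj) ?zrange_uniq// => i.
rewrite mem_zrange -(opprK i) (mem_map oppr_inj) mem_zrange opprK; lia.
Qed.

Lemma residue_qmulC A B : residue (qmul q A B 0) = residue (qmul q B A 0).
Proof. exact: (qpairC A B). Qed.

Lemma qpairNl A X : qpair q (- A) X = - qpair q A X.
Proof.
apply/eqP; rewrite -addr_eq0 -qpairDl addNr.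
by rewrite (@qpair_seq _ _ [::]) ?big_nil// => i _; rewrite mul0r.
Qed.

Lemma qpairZl c A X : qpair q (c *: A) X = c * qpair q A X.
Proof.
have [n1 E1] := qpair_bounded A X; have [n2 E2] := qpair_bounded (c *: A) X.
rewrite (E1 (maxn n1 n2)) ?leq_maxl// (E2 (maxn n1 n2)) ?leq_maxr//.
rewrite mulr_sumr; apply: eq_bigr => i _.
by rewrite qcoefZ -mulrA residue_lcstM.
Qed.

Lemma qpairA A B X : qpair q (qmul q A B) X = qpair q A (qmul q B X).
Proof. by rewrite /qpair qmulA. Qed.


Lemma qpair_part (P : pred int) A B :
  qpair q (part P A) B = qpair q A (part (fun i => P (- i)) B).
Proof.
have [n1 E1] := qpair_bounded (part P A) B.
have [n2 E2] := qpair_bounded A (part (fun i => P (- i)) B).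
rewrite (E1 (maxn n1 n2)) ?leq_maxl// (E2 (maxn n1 n2)) ?leq_maxr//.
apply: eq_bigr => i _; rewrite !coef_part opprK.
by case: ifP; rewrite // raddf0 mul0r mulr0.
Qed.

Lemma qpair_low_op n (d : qpdo C) (x : 'rV[laurent C]_n) :
  qpair q d (low_op x) = \sum_(j < n) residue (hpow q j (d (- j%:Z)) * x 0 j).
Proof.
rewrite qpairC (@qpair_seq _ _ [seq Posz k | k <- iota 0 n]); first last.
- move=> i inr; rewrite /low_op qcoef_sum big1 ?mul0r// => j _.
  rewrite /= /mono_fun; case: eqP => // ij; case/negP: inr.
  by rewrite ij mem_map ?mem_iota ?ltn_ord//; move=> a b [].
- by rewrite map_inj_uniq ?iota_uniq// => a b [].
rewrite big_map (_ : iota 0 n = index_iota 0 n) ?big_mkord; last first.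
  by rewrite /index_iota subn0.
apply: eq_bigr => j _.
rewrite mulrC; congr (residue (_ * _)).
rewrite /low_op qcoef_sum (bigD1 j)//= /mono_fun eqxx big1 ?addr0// => k kj.
by rewrite eqz_nat eq_sym; case: eqP => // /val_inj jk; rewrite jk eqxx in kj.
Qed.

End QpdoTheory.

(** * The residue pairing on matrices *)

Section MatrixTwist.
Variables (C : fieldType) (q : C).
Hypothesis q0 : q != 0.

Lemma map_hpowM i m n p (A : 'M[laurent C]_(m, n)) (B : 'M[laurent C]_(n, p)) :
  map_mx (hpow q i) (A *m B) = map_mx (hpow q i) A *m map_mx (hpow q i) B.
Proof.
apply/matrixP => j k; rewrite !mxE raddf_sum; apply: eq_bigr => l _.
by rewrite [LHS]hpowM// !mxE.
Qed.

Lemma map_hpow1 i n : map_mx (hpow q i) (1%:M : 'M[laurent C]_n) = 1%:M.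
Proof.
by apply/matrixP => j k; rewrite !mxE; case: eqP => _; rewrite ?hpow1 ?raddf0.
Qed.

End MatrixTwist.

Section MatrixPairing.
Variables (C : fieldType) (q : C) (n : nat).
Hypothesis q0 : q != 0.
Local Notation LM := 'M[laurent C]_n.
Implicit Types A B X : LM.

Lemma mxpairE A B : mxpair A B = \sum_i \sum_j residue (A i j * B j i).
Proof.
rewrite /mxpair /mxint raddf_sum; apply: eq_bigr => i _.
by rewrite mxE raddf_sum.
Qed.

Lemma mxpair_delta X y i j : mxpair (y *: delta_mx j i) X = residue (y * X i j).
Proof.
rewrite mxpairE (bigD1 j)//= (bigD1 i)//= !mxE !eqxx mulr1.
rewrite [X in _ + X]big1 ?addr0 => [|k kj]; last first.
  by rewrite big1// => l _; rewrite !mxE (negPf kj) andFb mulr0n mulr0 [0 * _]mul0r raddf0.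
rewrite big1 ?addr0// => k ki.
by rewrite !mxE (negPf ki) andbF mulr0n mulr0 [0 * _]mul0r raddf0.
Qed.

Lemma mxpairC A B : mxpair A B = mxpair B A.
Proof. by rewrite /mxpair /mxint mxtrace_mulC. Qed.
Lemma mxpairA A B X : mxpair (A *m B) X = mxpair A (B *m X).
Proof. by rewrite /mxpair mulmxA. Qed.
Lemma mxpairDl A B X : mxpair (A + B) X = mxpair A X + mxpair B X.
Proof. by rewrite /mxpair mulmxDl /mxint !raddfD. Qed.
Lemma mxpairDr A B X : mxpair X (A + B) = mxpair X A + mxpair X B.
Proof. by rewrite ![mxpair X _]mxpairC mxpairDl. Qed.
Lemma mxpairNl A X : mxpair (- A) X = - mxpair A X.
Proof. by rewrite /mxpair mulNmx /mxint !raddfN. Qed.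
Lemma mxpairNr A X : mxpair X (- A) = - mxpair X A.
Proof. by rewrite mxpairC mxpairNl mxpairC. Qed.
Lemma mxpairBr A B X : mxpair X (A - B) = mxpair X A - mxpair X B.
Proof. by rewrite mxpairDr mxpairNr. Qed.
Lemma mxpairZl c A X : mxpair (lcst c *: A) X = c * mxpair A X.
Proof.
by rewrite /mxpair -scalemxAl /mxint mxtraceZ residue_lcstM.
Qed.
Lemma mxpair_hpow m A B : mxpair (mxhpow q m A) (mxhpow q m B) = mxpair A B.
Proof.
rewrite /mxpair /mxint /mxhpow -map_hpowM//.
rewrite -(residue_hpow q m (\tr (A *m B))); congr residue.
by rewrite raddf_sum; apply: eq_bigr => i _; rewrite mxE.
Qed.

End MatrixPairing.

(** * Functions with representable differentials *)

Section Gradable.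
Variables (C : numFieldType) (q : C) (n : nat).
Hypothesis q0 : q != 0.
Local Notation LM := 'M[laurent C]_n.
Local Notation finrank_fun := (@finrank_diff _ _ (laurent C)^o).

(** A differential has to be transposed to produce a gradient; [G] is the
    transpose. *)
Definition adjointable (T : LM -> laurent C) : Prop :=
  exists G : laurent C -> LM, forall y X, residue (y * T X) = mxpair (G y) X.

(** The same [T] differentiates finite-rank families and has a transpose, so
    that both properties propagate together through sums, products and
    dilations, i.e. to all polynomials in the entries and their dilates. *)
Definition gradable (P : LM -> laurent C) : Prop :=
  forall A, exists2 T, adjointable T &
    forall (V : normedModType C) (F dF : V -> LM),
      F 0 = A -> finrank_diff F dF -> finrank_fun (P \o F) (T \o dF).

Lemma gradable_ext P P' : P =1 P' -> gradable P -> gradable P'.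
Proof.
move=> PP' nP A; have [T Ta Tf] := nP A; exists T => // V F dF F0 FdF.
by apply: finrank_diff_ext (Tf V F dF F0 FdF) => // s /=; rewrite PP'.
Qed.

Lemma gradable_cst c : gradable (fun=> c).
Proof.
move=> A; exists (fun=> 0).
  exists (fun=> 0) => y X; rewrite mulr0 raddf0 /mxpair mul0mx.
  by rewrite /mxint !raddf0.
by move=> V F dF _ _; exact: finrank_diff_cst.
Qed.

Lemma gradable_entry i j : gradable (fun A => A i j).
Proof.
move=> A; exists (fun X => X i j).
  by exists (fun y => y *: delta_mx j i) => y X; rewrite mxpair_delta.
move=> V F dF _ [I [g [dg [Y [gE dgE gd]]]]].
exists I, g, dg, (fun k => Y k i j); split=> // s /=.
  by rewrite gE summxE; apply: eq_bigr => k _; rewrite mxE.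
by rewrite dgE summxE; apply: eq_bigr => k _; rewrite mxE.
Qed.

Lemma gradableD P1 P2 : gradable P1 -> gradable P2 -> gradable (fun A => P1 A + P2 A).
Proof.
move=> n1 n2 A; have [T1 [G1 G1E] T1f] := n1 A; have [T2 [G2 G2E] T2f] := n2 A.
exists (fun X => T1 X + T2 X).
  exists (fun y => G1 y + G2 y) => y X.
  by rewrite mulrDr raddfD /= G1E G2E mxpairDl.
by move=> V F dF F0 FdF; apply: finrank_diffD; [exact: T1f|exact: T2f].
Qed.

Lemma gradableM P1 P2 : gradable P1 -> gradable P2 -> gradable (fun A => P1 A * P2 A).
Proof.
move=> n1 n2 A; have [T1 [G1 G1E] T1f] := n1 A; have [T2 [G2 G2E] T2f] := n2 A.
exists (fun X => P1 A * T2 X + T1 X * P2 A).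
  exists (fun y => G2 (y * P1 A) + G1 (y * P2 A)) => y X.
  by rewrite mxpairDl -G1E -G2E -raddfD; congr residue; ring.
move=> V F dF F0 FdF.
apply: finrank_diff_ext (finrank_diffM (T1f V F dF F0 FdF) (T2f V F dF F0 FdF)) => // v /=.
by rewrite F0.
Qed.

Lemma gradable_hpow m P : gradable P -> gradable (fun A => hpow q m (P A)).
Proof.
move=> nP A; have [T [G GE] Tf] := nP A.
exists (fun X => hpow q m (T X)).
  exists (fun y => G (hpow q (- m) y)) => y X.
  by rewrite -GE -[LHS](residue_hpow q (- m)) hpowM// hpowK.
move=> V F dF F0 FdF.
apply: (@finrank_diff_map _ _ (laurent C)^o (laurent C)^o (hpow q m)); last exact: Tf.
by move=> c w; rewrite [LHS]hpowM// hpow_lcst.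
Qed.

Lemma gradable_sum (I : Type) (r : seq I) (P : I -> LM -> laurent C) :
  (forall i, gradable (P i)) -> gradable (fun A => \sum_(i <- r) P i A).
Proof.
move=> nP; elim: r => [|i r IHr].
  by apply: gradable_ext (gradable_cst 0) => A; rewrite big_nil.
by apply: gradable_ext (gradableD (nP i) IHr) => A; rewrite big_cons.
Qed.

Lemma gradable_prod (I : Type) (r : seq I) (P : I -> LM -> laurent C) :
  (forall i, gradable (P i)) -> gradable (fun A => \prod_(i <- r) P i A).
Proof.
move=> nP; elim: r => [|i r IHr].
  by apply: gradable_ext (gradable_cst 1) => A; rewrite big_nil.
by apply: gradable_ext (gradableM (nP i) IHr) => A; rewrite big_cons.
Qed.

Lemma gradable_det m (B : LM -> 'M[laurent C]_m) :
  (forall i j, gradable (fun A => B A i j)) -> gradable (fun A => \det (B A)).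
Proof.
move=> nB; apply: gradable_sum => s; apply: gradableM; first exact: gradable_cst.
exact: gradable_prod.
Qed.

(** The derivative of [phi] is a finite sum of residues, and transposing the
    differentials of the [p j] turns each of them into a matrix pairing. *)
Lemma functional_gl_comp (phi : 'rV[laurent C]_n -> C)
    (p : 'I_n -> LM -> laurent C) : functional_M q phi ->
  (forall j, gradable (p j)) -> functional_gl (fun A => phi (\row_j p j A)).
Proof.
move=> [phid phiD] np.
have chain (A : LM) : exists2 T : LM -> 'rV[laurent C]_n,
    (forall j, adjointable (fun X => T X 0 j)) &
    forall (V : normedModType C) (F dF : V -> LM), F 0 = A -> finrank_diff F dF ->
      finrank_diff (fun s => \row_j p j (F s)) (fun v => T (dF v)).
  have /choice[T TP] : forall j, exists T, adjointable T /\
    forall (V : normedModType C) (F dF : V -> LM),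
      F 0 = A -> finrank_diff F dF -> finrank_fun (p j \o F) (T \o dF).
    by move=> j; have [T ? ?] := np j A; exists T.
  exists (fun X => \row_j T j X) => [j|V F dF F0 FdF].
    by have [[G GE] _] := TP j; exists G => y X; rewrite mxE.
  have rowE (f : 'I_n -> laurent C) :
      \row_j f j = \sum_j f j *: delta_mx 0 j :> 'rV__.
    by rewrite [LHS]row_sum_delta; apply: eq_bigr => j _; rewrite mxE.
  apply: (@finrank_diff_ext _ _ _ (fun s => \sum_j p j (F s) *: delta_mx 0 j) _
      (fun v => \sum_j T j (dF v) *: delta_mx 0 j)) => [s|v|]; rewrite ?rowE//.
  apply: finrank_diff_sum => j; have [_ /(_ V F dF F0 FdF)] := TP j.
  move=> [I [g [dg [Y [gE dgE gd]]]]].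
  exists I, g, dg, (fun k => Y k *: delta_mx 0 j); split=> // s.
    rewrite (gE s : p j (F s) = _) scaler_suml; apply: eq_bigr => k _.
    by rewrite scalerA.
  rewrite (dgE s : T j (dF s) = _) scaler_suml; apply: eq_bigr => k _.
  by rewrite scalerA.
have rowd u : exists2 l, (forall X, has_dderiv phi u X (l X)) &
    exists c : 'I_n -> laurent C, forall x, l x = \sum_j residue (c j * x 0 j).
  have [d dP] := phiD u; exists (fun x => qpair q d (low_op x)) => //.
  exists (fun j : 'I_n => hpow q j (d (- j%:Z))) => x; exact: qpair_low_op.
split=> [A k X|A].
  have [T _ Tf] := chain A; have [l lP _] := rowd (\row_j p j A).
  pose F (s : 'rV[C]_k) := A + \sum_(i < k) lcst (s 0 i) *: X i.
  have F0 : F 0 = A.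
    by rewrite /F big1 ?addr0// => i _; rewrite mxE rmorph0 scale0r.
  have FdF : finrank_diff F (fun s => 0 + \sum_(i < k)
      lcst ('d (fun s : 'rV[C]_k => s 0 i : C^o) (0 : 'rV[C]_k) s) *: X i).
    apply: finrank_diffD; first exact: finrank_diff_cst.
    apply: finrank_diff_sum => i; apply: finrank_diff_term; apply: differentiableP.
    exact: differentiable_coord.
  have := Tf _ _ _ F0 FdF => /(chain_rule phid).
  by rewrite F0 => /(_ l lP) /@ex_diff.
have [T Ta Tf] := chain A; have [l lP [c lE]] := rowd (\row_j p j A).
have /choice[G GE] : forall j, exists G, forall y X,
    residue (y * T X 0 j) = mxpair (G y) X by move=> j; exact: Ta.
exists (\sum_j G j (c j)) => X.
have -> : mxpair (\sum_j G j (c j)) X = l (T X).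
  rewrite lE; under [RHS]eq_bigr do rewrite GE.
  apply: (big_ind2 (fun a b => mxpair a X = b)) => //.
    by rewrite /mxpair mul0mx /mxint !raddf0.
  by move=> a b a' b' <- <-; rewrite mxpairDl.
have F0 : A + lcst 0 *: X = A by rewrite rmorph0 scale0r addr0.
have FdF : finrank_diff (fun t : C^o => A + lcst t *: X) (fun t => 0 + lcst t *: X).
  by apply: finrank_diffD; [exact: finrank_diff_cst|apply: finrank_diff_term; exact: is_diff_id].
have := Tf _ _ _ F0 FdF => /(has_dderiv_chain phid).
by rewrite F0 rmorph1 scale1r add0r => /(_ l lP).
Qed.

End Gradable.

(** * Invariant lifts from a cyclic covector *)

Section LowerUnipotent.
Variables (C : fieldType) (n : nat).
Implicit Types S : 'M[laurent C]_n.

Lemma LNminus_det S : LNminus S -> \det S = 1.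
Proof.
move=> SL; rewrite det_trig; last first.
  by apply/is_trig_mxP => i j ij; exact: (SL i j).2.
by rewrite big1// => i _; exact: (SL i i).1.
Qed.

Lemma LNminus_unit S : LNminus S -> S \in unitmx.
Proof. by move=> SL; rewrite unitmxE LNminus_det// unitr1. Qed.

Lemma LNminus1 : LNminus (1%:M : 'M[laurent C]_n).
Proof.
move=> i j; rewrite mxE; split=> [->|]; first by rewrite eqxx.
by case: eqP => // ->; rewrite ltnn.
Qed.

End LowerUnipotent.

Section CyclicVector.
Variables (C : fieldType) (q : C) (n' : nat).
Hypothesis q0 : q != 0.
Local Notation n := n'.+1.
Local Notation LM := 'M[laurent C]_n.
Implicit Types (A S : LM) (u : 'rV[laurent C]_n).

(** For a solution of h Psi = A Psi with first component psi_0, one has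
    h^k psi_0 = cyclic_row k A * Psi. Lower unipotent gauge transformations do
    not change psi_0. *)
Fixpoint cyclic_row k A : 'rV[laurent C]_n :=
  if k is k.+1 then map_mx (hpow q 1) (cyclic_row k A) *m A else delta_mx 0 0.

Lemma delta0_LNminus S : LNminus S -> delta_mx 0 0 *m invmx S = delta_mx 0 0 :> 'rV_n.
Proof.
move=> SL; have {1}<- : delta_mx 0 0 *m S = delta_mx 0 0 :> 'rV_n.
  rewrite -rowE; apply/rowP => j; rewrite !mxE eqxx /=.
  have [S1 S0] := SL 0 j; case: eqP => [j0|/eqP j0].
    by rewrite S1.
  by apply: S0; rewrite lt0n.
by rewrite mulmxK// LNminus_unit.
Qed.

Lemma cyclic_row_gauge k S A : LNminus S ->
  cyclic_row k (gauge q S A) = cyclic_row k A *m invmx S.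
Proof.
move=> SL; elim: k => [|k IHk] /=; first by rewrite delta0_LNminus.
rewrite IHk /gauge map_hpowM// -!mulmxA; congr (_ *m _).
rewrite mulmxA -map_hpowM// mulVmx ?LNminus_unit//.
by rewrite map_hpow1// mul1mx.
Qed.

Lemma cyclic_row_companion u k : (k < n)%N ->
  cyclic_row k (companion u) = \row_j ((j : nat) == k)%:R.
Proof.
elim: k => [|k IHk] kn.
  by apply/rowP => j; rewrite !mxE eqxx.
rewrite /= IHk; last exact: ltnW.
have -> : map_mx (hpow q 1) (\row_(j < n) ((j : nat) == k)%:R) =
    delta_mx 0 (Ordinal (ltnW kn)).
  apply/rowP => j; rewrite !mxE eqxx /= -val_eqE /=.
  by case: eqP; rewrite ?hpow1 ?raddf0.
by rewrite -rowE; apply/rowP => j; rewrite !mxE /= ltn_eqF.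
Qed.

Lemma cyclic_row_companion_last u : cyclic_row n (companion u) = - u.
Proof.
rewrite [LHS]/= cyclic_row_companion//.
have -> : map_mx (hpow q 1) (\row_(j < n) ((j : nat) == n')%:R) =
    delta_mx 0 ord_max.
  apply/rowP => j; rewrite !mxE eqxx /= -val_eqE /=.
  by case: eqP; rewrite ?hpow1 ?raddf0.
by rewrite -rowE; apply/rowP => j; rewrite !mxE /= eqxx.
Qed.

Definition cramer_mx (j : 'I_n) A : LM :=
  \matrix_(i, k) cyclic_row (if i == j then n else i) A 0 k.

(** On the cross-section h^n psi_0 + sum_j u_j h^j psi_0 = 0, and Cramer's rule
    for the rows v_0, ..., v_n expresses u_j as a quotient by
    det (v_0, ..., v_(n-1)), which is 1 there. Without the denominator it is a
    polynomial on all matrices, and remains invariant because gauge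
    transformations have determinant 1. *)
Definition coeff_inv (j : 'I_n) A : laurent C := - \det (cramer_mx j A).

Lemma coeff_inv_gauge j S A : LNminus S ->
  coeff_inv j (gauge q S A) = coeff_inv j A.
Proof.
move=> SL; congr (- _).
have -> : cramer_mx j (gauge q S A) = cramer_mx j A *m invmx S.
  apply/matrixP => i k; rewrite [LHS]mxE cyclic_row_gauge// mxE [RHS]mxE.
  by apply: eq_bigr => l _; rewrite [X in _ = X * _]mxE.
by rewrite det_mulmx det_inv (LNminus_det SL) invr1 mulr1.
Qed.

Lemma coeff_inv_companion j u : coeff_inv j (companion u) = u 0 j.
Proof.
rewrite /coeff_inv (expand_det_row _ j).
have cofE k : cofactor (cramer_mx j (companion u)) j k = (k == j)%:R.
  transitivity (cofactor (1%:M : LM) j k).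
    rewrite /cofactor; congr (_ * \det _); apply/matrixP => i l.
    rewrite !mxE eq_sym (negPf (neq_lift _ _)) cyclic_row_companion// mxE.
    by rewrite -val_eqE eq_sym.
  by have := mul_mx_adj (1%:M : LM); rewrite mul1mx det1 => /matrixP /(_ k j);
     rewrite !mxE.
rewrite (bigD1 j)//= big1 ?addr0 => [|k kj]; last first.
  by rewrite cofE (negPf kj) mulr0.
by rewrite cofE eqxx mulr1 mxE eqxx cyclic_row_companion_last mxE opprK.
Qed.

End CyclicVector.

Section LiftExistence.
Variables (C : numFieldType) (q : C) (n' : nat).
Hypothesis q0 : q != 0.
Local Notation n := n'.+1.

Lemma gradable_cyclic_row k j : gradable (fun A : 'M[laurent C]_n => cyclic_row q k A 0 j).
Proof.
elim: k j => [|k IHk] j /=; first exact: gradable_cst.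
apply: (@gradable_ext _ _
  (fun A : 'M[laurent C]_n => \sum_i hpow q 1 (cyclic_row q k A 0 i) * A i j)).
  by move=> A; rewrite mxE; apply: eq_bigr => i _; rewrite mxE.
apply: gradable_sum => i; apply: gradableM; last exact: gradable_entry.
exact: gradable_hpow.
Qed.

Lemma gradable_coeff_inv j : gradable (@coeff_inv C q n' j).
Proof.
apply: (@gradable_ext _ _ (fun A => lcst (-1) * \det (cramer_mx q j A))).
  by move=> A; rewrite rmorphN1 mulN1r.
apply: gradableM; first exact: gradable_cst.
apply: gradable_det => i k; apply: gradable_ext (gradable_cyclic_row (if i == j then n else i) k).
by move=> A; rewrite mxE.
Qed.

Lemma lift_exists (phi : 'rV[laurent C]_n -> C) : functional_M q phi ->
  exists f, is_lift q phi f.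
Proof.
move=> phiF; exists (fun A => phi (\row_j coeff_inv q j A)); split.
- by apply: (functional_gl_comp q0 phiF) => j; exact: gradable_coeff_inv.
- by move=> S A SL; congr phi; apply/rowP => j; rewrite !mxE (coeff_inv_gauge q0).
- move=> A u [_ [S SL SA]]; congr phi; apply/rowP => j; rewrite mxE.
  by rewrite -(coeff_inv_gauge q0 j A SL) SA coeff_inv_companion.
Qed.

End LiftExistence.

(** * Constraints on the gradient of a lift *)

Section LiftGradient.
Variables (C : numFieldType) (q : C) (n' : nat).
Hypothesis q0 : q != 0.
Local Notation n := n'.+1.
Local Notation LM := 'M[laurent C]_n.

Lemma pi_rel_companion (u : 'rV[laurent C]_n) : pi_rel q (companion u) u.
Proof.
split.
  move=> i j; rewrite !mxE; split.
    move=> ji; rewrite ji eqxx; case: eqP => // ni.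
    by have := ltn_ord j; lia.
  move=> ij; rewrite (gtn_eqF ij); case: eqP => // ni.
  by have := ltn_ord j; lia.
exists 1%:M; first exact: LNminus1.
by rewrite /gauge /mxhpow map_hpow1// mul1mx invmx1 mulmx1.
Qed.

(** Moving the last row of a companion matrix stays on the cross-section,
    where the lift is the given functional. *)
Lemma lift_gradient_last_col phi f (u : 'rV[laurent C]_n) dphi df j :
  is_lift q phi f -> is_differential q phi u dphi ->
  is_gradient f (companion u) df ->
  df j ord_max = - hpow q j (dphi (- j%:Z)).
Proof.
move=> [_ _ fphi] dphiP dfP; apply/eqP; rewrite -subr_eq0 opprK; apply/eqP.
apply: residue_eq0 => y.
have [_] := dphiP (y *: delta_mx 0 j).
have [_] := dfP (- y *: delta_mx ord_max j).
have -> : (fun t : C^o => f (companion u + lcst t *: (- y *: delta_mx ord_max j)) : C^o)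
   = (fun t : C^o => phi (u + lcst t *: (y *: delta_mx 0 j)) : C^o).
  apply/funext => t; apply: fphi.
  suff -> : companion u + lcst t *: (- y *: delta_mx ord_max j) =
    companion (u + lcst t *: (y *: delta_mx 0 j)) by exact: pi_rel_companion.
  apply/matrixP => i k; rewrite !mxE eqSS -(val_eqE i ord_max) /=.
  case: eqP => _; last by rewrite !mulr0 addr0.
  by rewrite /= mulNr mulrN opprD.
move=> -> /eqP; rewrite mxpairC mxpair_delta// qpair_low_op//.
rewrite (bigD1 j)//= big1 => [|k kj]; last first.
  by rewrite !mxE (negPf kj) andbF mulr0n !mulr0 raddf0.
rewrite addr0 !mxE !eqxx mulr1 mulNr raddfN /= eq_sym -addr_eq0 => /eqP E.
by rewrite mulrDl raddfD /= addrC [df _ _ * y]mulrC.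
Qed.

(** First-order invariance along the gauge curve 1 + t s, with s a multiple of
    an elementary matrix below the diagonal: since s^2 = 0, the orbit is the
    polynomial curve A + t (hs A - A s) - t^2 hs A s. *)
Lemma lift_gradient_gauge phi f (A df : LM) (a b : 'I_n) :
  is_lift q phi f -> is_gradient f A df -> (b < a)%N ->
  hpow q (-1) ((A *m df) b a) = (df *m A) b a.
Proof.
move=> [[fd _] finv _] dfP ba; apply/eqP; rewrite -subr_eq0; apply/eqP.
apply: residue_eq0 => y.
have [s sE] : {s : LM | s = y *: delta_mx a b} by exists (y *: delta_mx a b).
have ss : s *m s = 0.
  by rewrite sE -scalemxAl -scalemxAr mul_delta_mx_0 ?scaler0// -val_eqE /= ltn_eqF.
pose hs := mxhpow q 1 s.
pose Y1 := hs *m A - A *m s.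
pose Y2 := - (hs *m A *m s).
pose F (t : C^o) : LM := A + (lcst t *: Y1 + lcst (t * t) *: Y2).
(* F t is the gauge transform of A by 1 + t s, whose inverse is 1 - t s *)
have FE t : f (F t) = f A.
  pose S : LM := 1%:M + lcst t *: s.
  have SL : LNminus S.
    move=> i j; rewrite /S sE !mxE; split=> [->|ij].
      rewrite eqxx; case: eqP => [ja|]; last by rewrite !mulr0 addr0.
      case: eqP => [jb|]; last by rewrite !mulr0 addr0.
      by move: ba; rewrite -ja -jb ltnn.
    rewrite -[i == j]val_eqE /= ltn_eqF// add0r.
    case: eqP => [ia|]; last by rewrite !mulr0.
    case: eqP => [jb|]; last by rewrite !mulr0.
    by move: ba; rewrite -ia -jb ltnNge ltnW.
  rewrite -(finv _ A SL); congr f; rewrite /gauge.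
  have -> : invmx S = 1%:M - lcst t *: s.
    apply: (can_inj (mulKmx (LNminus_unit SL))).
    rewrite mulmxV ?LNminus_unit// mulmxBr mulmx1 mulmxDl mul1mx.
    by rewrite -scalemxAl -scalemxAr ss !scaler0 addr0 addrK.
  have -> : mxhpow q 1 S = 1%:M + lcst t *: hs.
    apply/matrixP => i j; rewrite !mxE raddfD /=.
    rewrite (hpowM q0 1 (lcst t)) hpow_lcst; congr (_ + _).
    by case: eqP; rewrite ?hpow1 ?raddf0.
  rewrite mulmxBr mulmx1 mulmxDl mul1mx mulmxDl -!scalemxAl -!scalemxAr.
  rewrite /F /Y1 /Y2. rewrite scalerBr scalerN.
  have -> : lcst (t * t) = lcst t * lcst t :> laurent C by exact: rmorphM.
  rewrite scalerA -!addrA. congr (_ + _).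
  by rewrite opprD !addrA.
have FdF : finrank_diff F (fun v => 0 +
    (lcst v *: Y1 + lcst ((0 : C^o) *: v + (0 : C^o) *: v) *: Y2)).
  have sq : is_diff (0 : C^o) (fun t : C^o => t * t : C^o)
      (fun v => (0 : C^o) *: v + (0 : C^o) *: v).
    by apply: (@is_diffM _ _ (id : C^o -> C^o) id); exact: is_diff_id.
  apply: finrank_diffD; first exact: finrank_diff_cst.
  by apply: finrank_diffD; [exact: (@finrank_diff_term _ _ _ id)|exact: finrank_diff_term].
have F0 : F 0 = A by rewrite /F mulr0 !rmorph0 !scale0r !addr0.
have := has_dderiv_chain fd _ FdF; rewrite F0 => /(_ _ dfP).
have -> : f \o F = cst (f A) by apply/funext => t; exact: FE.
move=> [_]; rewrite derive_cst !scale0r addr0 rmorph0 scale0r addr0 add0r.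
rewrite rmorph1 scale1r /Y1 mxpairBr [mxpair _ (hs *m A)]mxpairC mxpairA.
rewrite -(mxpairA df A s) [mxpair _ s]mxpairC sE.
have -> : hs = hpow q 1 y *: delta_mx a b.
  apply/matrixP => i j; rewrite /hs sE !mxE hpowM//; congr (_ * _).
  by case: (_ && _); rewrite ?hpow1 ?raddf0.
rewrite !mxpair_delta => E.
by rewrite [RHS]E mulrC mulrBr raddfB /= -(residue_hpow q 1 (y * hpow _ _ _)) (hpowM q0 1 y) hpowVK.
Qed.

End LiftGradient.

(** * Cyclic difference equations and the matrix bracket *)

Section DifferenceEquation.
Variables (C : fieldType) (q : C).
Hypothesis q0 : q != 0.
Hypothesis q_inf : forall k : int, k != 0 -> q ^ k != 1.
Implicit Types f : laurent C.

(** At k = 0 the factor is 0^-1 = 0, so the solution has zero residue. *)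
Definition solve_1mh (m : int) f : laurent C :=
  smap (fun k : int => *:%R ((1 - q ^ (m * k))^-1) : {additive C^o -> C^o}) f.

Lemma solve_1mhP m f : m != 0 -> residue f = 0 ->
  solve_1mh m f - hpow q m (solve_1mh m f) = f.
Proof.
move=> m0 f0; apply: eq_series => k; rewrite lcoefB coef_hpow -[solve_1mh m f k]/(_ * _).
rewrite -{1}[_ * f k]mul1r -mulrBl mulrA.
have [->|k0] := eqVneq k 0; first by rewrite -/(residue f) f0 mulr0.
by rewrite mulfV ?mul1r// subr_eq0 eq_sym q_inf// mulf_neq0.
Qed.

Lemma residue_solve_1mh m f : residue f = 0 -> residue (solve_1mh m f) = 0.
Proof. by move=> f0; rewrite /residue -[LHS]/(_ * residue f) f0 mulr0. Qed.

Lemma hpow_fixed m f : m != 0 -> hpow q m f = f -> f = lcst (residue f).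
Proof.
move=> m0 fE; apply: eq_series => k; rewrite coef_lcst.
case: eqP => [->//|/eqP k0]; apply/eqP.
have /eqP := congr1 (fun g : laurent C => g k) fE.
rewrite coef_hpow -subr_eq0 -{2}[f k]mul1r -mulrBl mulf_eq0 subr_eq0.
by rewrite (negPf (q_inf _)) ?mulf_neq0.
Qed.

End DifferenceEquation.

Section DiagonalPart.
Variables (C : fieldType) (q : C) (n : nat).
Hypothesis q0 : q != 0.
Local Notation LM := 'M[laurent C]_n.
Implicit Types A B X Y Z W : LM.

Definition is_lower A := forall i j : 'I_n, (i < j)%N -> A i j = 0.

Lemma mx_entryB X Y i j : (X - Y) i j = X i j - Y i j.
Proof. by rewrite !mxE. Qed.

Lemma mxPzeroB X Y : mxPzero (X - Y) = mxPzero X - mxPzero Y.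
Proof. by apply/matrixP => i j; rewrite !mxE; case: eqP; rewrite ?subr0. Qed.
Lemma mxPzeroD X Y : mxPzero (X + Y) = mxPzero X + mxPzero Y.
Proof. by apply/matrixP => i j; rewrite !mxE; case: eqP; rewrite ?addr0. Qed.
Lemma mxPzero_id X : mxPzero (mxPzero X) = mxPzero X.
Proof. by apply/matrixP => i j; rewrite !mxE; case: eqP. Qed.

Lemma mxPzero_hpow m X : mxPzero (mxhpow q m X) = mxhpow q m (mxPzero X).
Proof. by apply/matrixP => i j; rewrite !mxE; case: eqP; rewrite ?raddf0. Qed.

Lemma mxint_sub X Y : mxint (X - Y) = mxint X - mxint Y.
Proof. by rewrite /mxint !raddfB. Qed.

Lemma mxintE X : mxint X = \sum_i residue (X i i).
Proof. by rewrite /mxint raddf_sum. Qed.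

Lemma mxint_hpow m X : mxint (mxhpow q m X) = mxint X.
Proof.
by rewrite !mxintE; apply: eq_bigr => i _; rewrite mxE residue_hpow.
Qed.

Lemma mxint_Pzero X : mxint (mxPzero X) = mxint X.
Proof. by rewrite !mxintE; apply: eq_bigr => i _; rewrite mxE eqxx. Qed.

Lemma thetaE A i j :
  theta q A i j = if i == j then hpow q 1 (A (ord_pred i) (ord_pred i)) else 0.
Proof. by rewrite !mxE. Qed.

Lemma mxPzero_theta A : mxPzero (theta q A) = theta q A.
Proof. by apply/matrixP => i j; rewrite !mxE; case: eqP. Qed.

Lemma thetaB A B : theta q (A - B) = theta q A - theta q B.
Proof.
apply/matrixP => i j; rewrite mx_entryB !thetaE mx_entryB raddfB.
by case: eqP; rewrite ?subr0.
Qed.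

Lemma thetaD A B : theta q (A + B) = theta q A + theta q B.
Proof.
apply/matrixP => i j; rewrite thetaE [RHS]mxE !thetaE mxE raddfD.
by case: eqP; rewrite ?addr0.
Qed.

Lemma theta_hpow m A : theta q (mxhpow q m A) = mxhpow q m (theta q A).
Proof.
apply/matrixP => i j; rewrite [RHS]mxE !thetaE.
by case: eqP; rewrite ?raddf0// !mxE !hpowD// addrC.
Qed.

Lemma theta_scalar c : theta q (lcst c)%:M = (lcst c)%:M :> LM.
Proof.
apply/matrixP => i j; rewrite thetaE !mxE eqxx mulr1n hpow_lcst.
by case: eqP.
Qed.

Lemma mxint_theta A : mxint (theta q A) = mxint A.
Proof.
rewrite !mxintE [RHS](reindex_inj (@ord_pred_inj n)) /=.
by apply: eq_bigr => i _; rewrite thetaE eqxx residue_hpow.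
Qed.

Lemma mxpair_diag B X : mxPzero B = B -> mxpair B X = \sum_i residue (B i i * X i i).
Proof.
move=> <-; rewrite mxpairE; apply: eq_bigr => i _.
rewrite (bigD1 i)//= !mxE eqxx big1 ?addr0// => j ji.
by rewrite !mxE eq_sym (negPf ji) [0 * _]mul0r raddf0.
Qed.

Lemma mxpair_Pzero B X : mxPzero B = B -> mxpair B (mxPzero X) = mxpair B X.
Proof.
move=> BE; rewrite !mxpair_diag//; apply: eq_bigr => i _.
by rewrite !mxE eqxx.
Qed.

Lemma mxpair_theta B X : mxPzero B = B ->
  mxpair (theta q B) (theta q X) = mxpair B X.
Proof.
move=> BE; rewrite !mxpair_diag ?mxPzero_theta//.
rewrite [RHS](reindex_inj (@ord_pred_inj n)) /=; apply: eq_bigr => i _.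
by rewrite !thetaE eqxx -hpowM// residue_hpow.
Qed.

Lemma mxpair_lower Z W : is_lower Z -> is_lower W ->
  mxpair Z W = mxpair (mxPzero Z) (mxPzero W).
Proof.
move=> Zl Wl; rewrite mxpair_Pzero ?mxPzero_id// [RHS]mxpair_diag ?mxPzero_id//.
rewrite mxpairE; apply: eq_bigr => i _; rewrite (bigD1 i)//= mxE eqxx.
rewrite big1 ?addr0// => j ji.
have [ij|] := ltnP i j; first by rewrite Zl// mul0r raddf0.
rewrite leq_eqVlt val_eqE (negPf ji) /= => lt_ji.
by rewrite [W j i]Wl// mulr0 raddf0.
Qed.

End DiagonalPart.

Section Cayley.
Variables (C : numFieldType) (q : C) (n' : nat).
Hypothesis q0 : q != 0.
Hypothesis q_inf : forall k : int, k != 0 -> q ^ k != 1.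
Local Notation n := n'.+1.
Local Notation LM := 'M[laurent C]_n.
Implicit Types A B X Y Z W : LM.

Lemma mxint_scalar c : mxint ((lcst c)%:M : LM) = n%:R * c.
Proof. by rewrite /mxint mxtrace_scalar raddfMn mulr_natl. Qed.

Lemma mxint_Pzero' A : mxint (mxPzero' A) = 0.
Proof.
rewrite mxint_sub mxint_Pzero mxint_scalar mulrA mulfV ?mul1r ?subrr//.
Qed.

Lemma mxPzero_Pzero' A : mxPzero (mxPzero' A) = mxPzero' A.
Proof.
rewrite mxPzeroB mxPzero_id; congr (_ - _).
by apply/matrixP => i j; rewrite !mxE; case: eqP.
Qed.

Lemma mxPzero'_id A : mxPzero A = A -> mxint A = 0 -> mxPzero' A = A.
Proof. by move=> AE A0; rewrite /mxPzero' AE A0 mulr0 rmorph0 raddf0 subr0. Qed.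

Lemma mxPzero'_int0 A : mxint A = 0 -> mxPzero' A = mxPzero A.
Proof. by move=> A0; rewrite /mxPzero' A0 mulr0 rmorph0 raddf0 subr0. Qed.

Lemma ord_predS (i : nat) (lt_i : (i.+1 < n)%N) :
  ord_pred (Ordinal lt_i) = Ordinal (ltnW lt_i).
Proof. by apply/val_inj; rewrite /= modnDr modn_small// ltnW. Qed.

Lemma ord_pred0 : ord_pred (ord0 : 'I_n) = ord_max.
Proof. by apply/val_inj; rewrite /= modn_small. Qed.

(** A fixed point has b_i = h b_(i-1) around the cycle, so b_0 = h^n b_0 is a
    constant and all the b_i are equal to it. *)
Lemma theta_fixed B : mxPzero B = B -> mxint B = 0 -> theta q B = B -> B = 0.
Proof.
move=> Bd B0 Bfix.
have step i : B i i = hpow q 1 (B (ord_pred i) (ord_pred i)).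
  by rewrite -{1}Bfix thetaE eqxx.
have iter_h i (lt_i : (i < n)%N) : B (Ordinal lt_i) (Ordinal lt_i) = hpow q i%:Z (B 0 0).
  elim: i lt_i => [|i IHi] lt_i.
    by rewrite hpow0; congr (B _ _); apply/val_inj.
  by rewrite step ord_predS IHi hpowD//; congr (hpow _ _ _); lia.
have B00 : B 0 0 = lcst (residue (B 0 0)).
  apply: (@hpow_fixed _ _ q_inf n%:Z) => //.
  rewrite [in RHS]step ord_pred0.
  have -> : ord_max = Ordinal (ltnSn n') :> 'I_n by exact: val_inj.
  by rewrite iter_h hpowD//; congr (hpow _ _ _); lia.
have Bi i : B i i = B 0 0.
  case: i => i lt_i; rewrite iter_h B00 hpow_lcst.
  by [].
have c0 : residue (B 0 0) = 0.
  move: B0; rewrite mxintE; under eq_bigr do rewrite Bi.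
  rewrite sumr_const card_ord -mulr_natl => /eqP.
  by rewrite mulf_eq0 pnatr_eq0 => /eqP.
rewrite -Bd; apply/matrixP => i j; rewrite !mxE; case: eqP => // <-.
by rewrite Bi B00 c0 rmorph0.
Qed.

(** [cayley A] is B + theta B for such a B. *)
Definition cayley_sol A B :=
  [/\ mxPzero B = B, mxint B = 0 & B - theta q B = mxPzero' A].

(** The recursion b_i = z_i + h b_(i-1) started from b_(n-1) = be gives
    b_i = c_i + h^(i+1) be. The cycle closes when be - h^n be = c_(n-1), which
    is solvable because the residue of c_(n-1) is the sum of those of the z_i,
    which is 0. *)
Lemma cayley_sol_exists A : exists B, cayley_sol A B.
Proof.
pose z (i : nat) := mxPzero' A (inord i) (inord i).
pose fix c (i : nat) : laurent C :=
  if i is j.+1 then z i + hpow q 1 (c j) else z 0%N.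
have res_c i : residue (c i) = \sum_(k < i.+1) residue (z k).
  elim: i => [|i IHi]; first by rewrite big_ord1.
  by rewrite big_ord_recr /= raddfD /= residue_hpow IHi addrC.
have c0 : residue (c n') = 0.
  transitivity (mxint (mxPzero' A)); last exact: mxint_Pzero'.
  rewrite res_c mxintE; apply: eq_bigr => i _.
  by rewrite /z inord_val.
pose be := solve_1mh q n%:Z (c n').
have beE : be - hpow q n%:Z be = c n' by exact: solve_1mhP.
pose b (i : nat) := c i + hpow q i.+1%:Z be.
pose B0 : LM := \matrix_(i, j) if i == j then b i else 0.
have B0d : mxPzero B0 = B0.
  by apply/matrixP => i j; rewrite !mxE; case: eqP.
have B0ii i : B0 i i = b i by rewrite mxE eqxx.
have B0E : B0 - theta q B0 = mxPzero' A.
  rewrite -mxPzero_Pzero'; apply/matrixP => i j.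
  rewrite mx_entryB thetaE [in RHS]mxE.
  case: eqP => [<-|/eqP ij]; last by rewrite mxE (negPf ij) subr0.
  rewrite !B0ii; case: i => -[|i] lt_i.
    have -> : Ordinal lt_i = ord0 by exact: val_inj.
    rewrite ord_pred0 /= {2}/b -beE subrK /b /= addrK /z.
    by congr (mxPzero' A _ _); apply/val_inj; rewrite /= inordK.
  rewrite ord_predS /b /= raddfD /= hpowD//.
  have -> : 1 + i.+1%:Z = i.+2%:Z by lia.
  rewrite opprD addrACA subrr addr0 addrK /z.
  by congr (mxPzero' A _ _); apply/val_inj; rewrite /= inordK.
exists (mxPzero' B0); split.
- exact: mxPzero_Pzero'.
- exact: mxint_Pzero'.
- rewrite -B0E /mxPzero' B0d thetaB theta_scalar.
  by rewrite opprB addrA subrK.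
Qed.

Lemma cayleyE A B : cayley_sol A B -> cayley q A = B + theta q B.
Proof.
move=> [Bd B0 BE].
suff E : inv_on (range (@mxPzero' C n)) (fun B => B - theta q B) (mxPzero' A) = B.
  by rewrite /cayley E.
rewrite /inv_on; case: xgetP => [B1 _ [[X _ B1E] B1eq]|/(_ B)]; last first.
  by case; split; [exists B; [|exact: mxPzero'_id]|exact: BE].
have B1d : mxPzero B1 = B1 by rewrite -B1E; exact: mxPzero_Pzero'.
have B10 : mxint B1 = 0 by rewrite -B1E; exact: mxint_Pzero'.
apply/eqP; rewrite -subr_eq0; apply/eqP; apply: theta_fixed.
- by rewrite mxPzeroB B1d Bd.
- by rewrite mxint_sub B10 B0 subrr.
- rewrite thetaB; apply/esym/eqP.
  by rewrite subr_eq -addrA [- _ + B]addrC addrC -subr_eq B1eq BE.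
Qed.

Lemma cayley_sub A B : cayley q (A - B) = cayley q A - cayley q B.
Proof.
have [X XP] := cayley_sol_exists A; have [Y YP] := cayley_sol_exists B.
rewrite (cayleyE XP) (cayleyE YP) (@cayleyE _ (X - Y)).
  by rewrite thetaB opprD addrACA.
case: XP => Xd X0 XE; case: YP => Yd Y0 YE; split.
- by rewrite mxPzeroB Xd Yd.
- by rewrite mxint_sub X0 Y0 subrr.
- rewrite thetaB opprD addrACA -opprD XE YE.
  have cE (a b : C) : (lcst (a - b))%:M = (lcst a)%:M - (lcst b)%:M :> LM.
    have -> : lcst (a - b) = lcst a - lcst b :> laurent C by exact: raddfB.
    exact: raddfB.
  by rewrite /mxPzero' mxPzeroB mxint_sub mulrBr cE [in LHS]opprD [in RHS]opprD addrACA.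
Qed.

Lemma cayley_hpow m A : cayley q (mxhpow q m A) = mxhpow q m (cayley q A).
Proof.
have hB (X Y : LM) : mxhpow q m (X - Y) = mxhpow q m X - mxhpow q m Y.
  by rewrite /mxhpow raddfB.
have [X XP] := cayley_sol_exists A.
rewrite (cayleyE XP) (@cayleyE _ (mxhpow q m X)).
  by rewrite theta_hpow// /mxhpow raddfD.
case: XP => Xd X0 XE; split.
- by rewrite mxPzero_hpow Xd.
- by rewrite mxint_hpow.
- rewrite (theta_hpow q0); apply: etrans (esym (hB _ _)) _; rewrite XE.
  apply: etrans (hB _ _) _; rewrite -mxPzero_hpow /mxPzero' mxint_hpow.
  congr (_ - _); apply/matrixP => i j; rewrite !mxE.
  by case: eqP; rewrite ?hpow_lcst ?raddf0.
Qed.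

(** On diagonal matrices [theta] is an isometry, so (1 + theta) / (1 - theta)
    is skew. Applying this twice replaces the normalized solution by any
    diagonal solutions B and B'. *)
Lemma mxpair_cayley Z W B B' : mxPzero B = B -> mxPzero B' = B' ->
  B - theta q B = mxPzero Z -> B' - theta q B' = mxPzero W ->
  mxpair (cayley q Z) W =
    mxpair (theta q B) B' - mxpair B (theta q B').
Proof.
move=> Bd Bd' BE BE'.
have Z0 : mxint Z = 0 by rewrite -mxint_Pzero -BE mxint_sub mxint_theta// subrr.
have [X XP] := cayley_sol_exists Z; rewrite (cayleyE XP).
case: XP => Xd _; rewrite mxPzero'_int0// -BE => XE.
have XTd : mxPzero (X + theta q X) = X + theta q X.
  by rewrite mxPzeroD Xd mxPzero_theta.
rewrite -(mxpair_Pzero _ XTd) -BE'.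
have -> : mxpair (X + theta q X) (B' - theta q B') = - mxpair (X - theta q X) (B' + theta q B').
  rewrite !(mxpairDl, mxpairDr, mxpairNl, mxpairNr) !mxpair_theta//; ring.
rewrite XE !(mxpairDl, mxpairDr, mxpairNl, mxpairNr) !mxpair_theta//; ring.
Qed.

(** [rhat] commutes with the dilation, hence after undoing the dilation of
    A df it acts on X1 - X2 only; for gauge-invariant functionals this matrix
    is lower triangular, and only the diagonal part of [rhat] survives. *)
Lemma S_bracketE A df dg :
  let X1 := mxhpow q (-1) (A *m df) in let X2 := df *m A in
  let Y1 := mxhpow q (-1) (A *m dg) in let Y2 := dg *m A in
  is_lower (X1 - X2) -> is_lower (Y1 - Y2) ->
  S_bracket q A df dg =
    2^-1 * (mxpair (cayley q (X1 - X2)) (Y1 - Y2)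
            + (mxpair X1 Y2 - mxpair X2 Y1)).
Proof.
move=> X1 X2 Y1 Y2 Zl Wl; rewrite /S_bracket.
have X1E : A *m df = mxhpow q 1 X1.
  by apply/matrixP => i j; rewrite !mxE hpowVK.
have Y1E : A *m dg = mxhpow q 1 Y1.
  by apply/matrixP => i j; rewrite !mxE hpowVK.
rewrite X1E Y1E -/X2 -/Y2.
have hK : mxhpow q (-1) (mxhpow q 1 X1) = X1.
  by apply/matrixP => i j; rewrite !mxE hpowK.
have hD (X Y : LM) : mxhpow q 1 (X + Y) = mxhpow q 1 X + mxhpow q 1 Y.
  by rewrite /mxhpow raddfD.
have hB (X Y : LM) : mxhpow q 1 (X - Y) = mxhpow q 1 X - mxhpow q 1 Y.
  by rewrite /mxhpow raddfB.
have hZ c (X : LM) : mxhpow q 1 (lcst c *: X) = lcst c *: mxhpow q 1 X.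
  by apply/matrixP => i j; rewrite !mxE hpowM// hpow_lcst.
have rhat_h X : rhat q (mxhpow q 1 X) = mxhpow q 1 (rhat q X).
  apply: etrans (esym (hZ _ _)); congr (_ *: _).
  apply: etrans (esym (hD _ _)); rewrite cayley_hpow; congr (_ + _).
  apply: etrans (esym (hB _ _)); congr (_ - _).
    by apply/matrixP => i j; rewrite !mxE; case: ifP; rewrite ?raddf0.
  by apply/matrixP => i j; rewrite !mxE; case: ifP; rewrite ?raddf0.
have rhatB X Y : rhat q (X - Y) = rhat q X - rhat q Y.
  rewrite /rhat cayley_sub -scalerBr; congr (_ *: _).
  have -> : mxPpos (X - Y) = mxPpos X - mxPpos Y.
    by apply/matrixP => i j; rewrite !mxE; case: ifP; rewrite ?subr0.
  have -> : mxPneg (X - Y) = mxPneg X - mxPneg Y.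
    by apply/matrixP => i j; rewrite !mxE; case: ifP; rewrite ?subr0.
  have gen (V : zmodType) (a b c d e f : V) :
      a - b - (c - d) + (e - f) = a - c + e - (b - d + f).
    rewrite [- (c - d)]opprB [- (b - d + f)]opprD [- (b - d)]opprB.
    by rewrite [d - c]addrC [a - b + _]addrACA [_ + (e - f)]addrACA [- b + d]addrC.
  exact: gen.
rewrite hK rhat_h /rhat_plus hD hZ.
have -> : mxhpow q 1 (rhat q X1) - (mxhpow q 1 (rhat q X2) + lcst 2^-1 *: mxhpow q 1 X2)
    = mxhpow q 1 (rhat q (X1 - X2) - lcst 2^-1 *: X2).
  by rewrite rhatB !hB hZ opprD addrA.
have -> : rhat_minus q X1 - rhat q X2 = rhat q (X1 - X2) - lcst 2^-1 *: X1.
  by rewrite rhatB [RHS]addrAC.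
rewrite mxpair_hpow//.
have rZ : mxpair (rhat q (X1 - X2)) (Y1 - Y2) = 2^-1 * mxpair (cayley q (X1 - X2)) (Y1 - Y2).
  rewrite /rhat mxpairZl; congr (_ * _).
  rewrite mxpairDl [X in X + _ = _](_ : _ = 0) ?add0r//.
  have -> : mxPpos (X1 - X2) = 0.
    by apply/matrixP => i j; rewrite mxE [RHS]mxE; case: ifP => // /Zl.
  rewrite sub0r mxpairNl mxpair_lower//.
    rewrite (_ : mxPzero _ = 0) ?/mxpair ?mul0mx ?/mxint ?raddf0//.
    by apply/matrixP => i j; rewrite !mxE; case: eqP => // ->; rewrite ltnn.
  by move=> i j ij; rewrite mxE ltnNge ltnW.
rewrite mulrDr -rZ !(mxpairDl, mxpairDr, mxpairNl, mxpairNr) !mxpairZl.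
ring.
Qed.

End Cayley.

(** * The scalar bracket in terms of one difference equation *)

Opaque qpair mxpair residue hpow lcst part mono.

Section Products.
Variables (C : fieldType) (q : C).
Implicit Types A B : qpdo C.

Lemma partD (P : pred int) A B : part P (A + B) = part P A + part P B.
Proof.
by apply: eq_series => k; rewrite qcoefD !coef_part; case: ifP; rewrite ?addr0.
Qed.

Lemma qmul_top A B (N M k : int) : (forall i, N < i -> A i = 0) ->
  (forall i, M < i -> B i = 0) -> N + M <= k ->
  qmul q A B k = if k == N + M then A N * hpow q N (B M) else 0.
Proof.
move=> AN BM NMk; rewrite (@coef_qmul _ _ _ _ _ [:: N]) ?big_seq1//.
  case: eqP => [->|/eqP kNM]; first by congr (_ * hpow _ _ (B _)); lia.
  by rewrite BM ?raddf0 ?mulr0//; lia.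
move=> i; rewrite inE => iN; have [Ni|] := ltP N i; first by rewrite AN ?mul0r.
by move=> iN'; rewrite BM ?raddf0 ?mulr0//; lia.
Qed.

Lemma qmul_bot A B (N M k : int) : (forall i, i < N -> A i = 0) ->
  (forall i, i < M -> B i = 0) -> k < N + M -> qmul q A B k = 0.
Proof.
move=> AN BM NMk; rewrite (@coef_qmul _ _ _ _ _ [::]) ?big_nil//.
move=> i _; have [iN|] := ltP i N; first by rewrite AN ?mul0r.
by move=> iN'; rewrite BM ?raddf0 ?mulr0//; lia.
Qed.

Lemma qpair_mono0 (f : laurent C) A : qpair q (mono 0 f) A = residue (f * A 0).
Proof.
rewrite (@qpair_seq _ _ _ _ [:: 0]) ?big_seq1//.
  by rewrite coef_mono eqxx hpow0 oppr0.
by move=> i; rewrite inE coef_mono => /negPf ->; rewrite mul0r.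
Qed.

Lemma hpow_qpdo_mono m (f : laurent C) :
  hpow_qpdo q m (mono 0 f) = mono 0 (hpow q m f).
Proof.
by apply: eq_series => k; rewrite coef_hpow_qpdo !coef_mono; case: eqP; rewrite ?raddf0.
Qed.

Lemma split_parts A : Ppos A + Pneg A + mono 0 (A 0) = A.
Proof.
apply: eq_series => k; rewrite !qcoefD !coef_part coef_mono.
by case: ltgtP => // [||->]; rewrite ?addr0 ?add0r.
Qed.

Lemma split_nonneg A : Ppos A + mono 0 (A 0) = part (fun i => 0 <= i) A.
Proof.
apply: eq_series => k; rewrite !qcoefD !coef_part coef_mono.
by case: ltgtP => [||->]; rewrite ?addr0 ?add0r.
Qed.

Lemma qpair_parts A B :
  qpair q (Ppos A) B + qpair q (Pneg A) B + residue (A 0 * B 0) = qpair q A B.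
Proof. by rewrite -{4}(split_parts A) !qpairDl qpair_mono0. Qed.

Lemma qpair_nonneg A B :
  qpair q (part (fun i => 0 <= i) A) B = qpair q (Ppos A) B + residue (A 0 * B 0).
Proof. by rewrite -split_nonneg qpairDl qpair_mono0. Qed.

End Products.

(** The elimination behind [GD_bracketE], with the operator parts abstracted
    to scalars: [al] and [kl] multiply like constants, and gb + be + kl and gb
    are the two solutions provided by [inv_1mhE]. *)
Lemma GD_tail_identity (C : numFieldType) (R : comNzRingType)
    (res : {additive R -> C}) (a b a' b' gb be al kl : R) (k r P1 N1 P2 N2 Q : C) :
  (forall w, res (al * w) = r * res w) -> (forall w, res (kl * w) = k * res w) ->
  res a' = res b' ->
  P2 + N2 + res (b * b') = Q -> P1 + N1 + res (a * a') = Q ->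
  2^-1 * (P1 - N1) +
  2^-1 * (res ((gb + be + kl) * a') + res ((gb + be + kl - (a - al)) * a')) +
  (- res ((gb - (b - al)) * a') + 2^-1 * res (al * a')) -
  (res ((gb + be + kl) * b') + 2^-1 * res (al * b') +
   (2^-1 * (P2 - N2) - 2^-1 * (res (gb * b') + res ((gb - (b - al)) * b')))) =
  P1 + res (a * a') - (P2 + res (b * b')) +
  (res ((be - (a - b)) * a') - res (be * b')).
Proof.
move=> alM klM ab' E2 E1.
have -> : N1 = Q - res (a * a') - P1 by rewrite -E1; ring.
have -> : N2 = Q - res (b * b') - P2 by rewrite -E2; ring.
rewrite !(opprB, opprD, mulrDl, mulNr, raddfD, raddfN) /= !alM !klM ab'.
by field.
Qed.

Lemma add_four_terms (V : zmodType) (a a' b b' c c' d d' : V) :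
  a + a' - (b + b') + (c + c' - (d + d')) =
  a - b + (c - d) + (a' - b' + (c' - d')).
Proof.
rewrite [- (b + b')]opprD [- (d + d')]opprD [a + a' + _]addrACA.
by rewrite [c + c' + _]addrACA [LHS]addrACA.
Qed.

Section MonicOp.
Variables (C : fieldType) (n : nat) (u : 'rV[laurent C]_n).
Local Notation L := (monic_op u).

Lemma monic_op_gt i : (n : int) < i -> L i = 0.
Proof.
move=> ni; rewrite /monic_op qcoefD coef_mono gt_eqF// /low_op qcoef_sum.
rewrite add0r big1// => j _; rewrite coef_mono; case: eqP => // ij.
by have := ltn_ord j; lia.
Qed.

Lemma monic_op_n : L n = 1.
Proof.
rewrite /monic_op qcoefD coef_mono eqxx /low_op qcoef_sum big1 ?addr0// => j _.
by rewrite coef_mono; case: eqP => // -[jn]; have := ltn_ord j; lia.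
Qed.

Lemma monic_op_lt0 i : i < 0 -> L i = 0.
Proof.
move=> i0; rewrite /monic_op qcoefD coef_mono lt_eqF; last by lia.
rewrite add0r /low_op qcoef_sum big1// => j _.
by rewrite coef_mono lt_eqF//; lia.
Qed.

Lemma monic_op_lt (j : 'I_n) : L j = u 0 j.
Proof.
rewrite /monic_op qcoefD coef_mono (_ : (Posz j == Posz n) = false); last first.
  by have := ltn_ord j; lia.
rewrite add0r /low_op qcoef_sum (bigD1 j)//= coef_mono eqxx big1 ?addr0// => k kj.
by rewrite coef_mono eqz_nat eq_sym; case: eqP => // /val_inj jk; rewrite jk eqxx in kj.
Qed.

End MonicOp.

Section GDFormula.
Variables (C : numFieldType) (q : C) (n : nat) (u : 'rV[laurent C]_n).
Hypothesis q0 : q != 0.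
Hypothesis q_inf : forall k : int, k != 0 -> q ^ k != 1.
Hypothesis n_gt0 : (0 < n)%N.
Local Notation L := (monic_op u).
Local Notation "A ** B" := (qmul q A B) (at level 40).
Implicit Types X Y : qpdo C.

(** The bracket once the operators (1 - hhat^n)^-1 are replaced by a single
    solution [be] of be - hhat^n be = (L X)_0 - (X L)_0. *)
Definition GD_form X (be : laurent C) Y : C :=
  qpair q (part (fun i => 0 <= i) (L ** X)) (L ** Y)
  - qpair q (part (fun i => 0 <= i) (X ** L)) (Y ** L)
  + (residue (hpow q n be * (L ** Y) 0) - residue (be * (Y ** L) 0)).

Lemma residue_monicC X : residue ((L ** X) 0) = residue ((X ** L) 0).
Proof. exact: residue_qmulC. Qed.

(** Both sides are Tr (L X L Y). *)
Lemma qpair_monic_cycle X Y : qpair q (L ** X) (L ** Y) = qpair q (X ** L) (Y ** L).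
Proof. by rewrite (qpairA q0) (qpairC q0) !(qpairA q0) (qmulA q0). Qed.

Lemma n_neq0 : (n : int) != 0. Proof. by lia. Qed.

Lemma inv_1mhE X : exists2 g, inv_1mh q n X = mono 0 g &
  g - hpow q n g = X 0 - lcst (residue (X 0)).
Proof.
have P0E A : Pzero' A = mono 0 (A 0 - lcst (residue (A 0))).
  apply: eq_series => k; rewrite /Pzero' /P00 /qcst /qTr /Pzero qcoefB.
  by rewrite !coef_mono !coef_part eqxx; case: eqP => [->|_]; rewrite ?subr0.
have mB (f g : laurent C) : mono 0 f - mono 0 g = mono 0 (f - g) :> qpdo C.
  by apply: eq_series => k; rewrite qcoefB !coef_mono; case: eqP; rewrite ?subr0.
have mI (f g : laurent C) : mono 0 f = mono 0 g :> qpdo C -> f = g.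
  by move=> /(congr1 (fun A : qpdo C => A 0)); rewrite coef_mono eqxx.
have hE := @hpow_qpdo_mono _ q.
rewrite /inv_1mh /inv_on; set f := X 0 - _.
have rf : residue f = 0 by rewrite raddfB /= residue_lcst subrr.
case: xgetP => [B _ [[A _ AB] BE]|/(_ (mono 0 (solve_1mh q n f)))].
  exists (A 0 - lcst (residue (A 0))); first by rewrite -AB P0E.
  by apply: mI; rewrite -mB -hE -P0E AB BE P0E.
case; split; last by rewrite hE mB solve_1mhP// ?n_neq0// P0E.
exists (mono 0 (solve_1mh q n f)) => //; rewrite P0E; congr mono.
by rewrite coef_mono eqxx residue_solve_1mh// rmorph0 subr0.
Qed.

(** The difference of the two solutions entering the bracket equals [be] up to
    a constant, which contributes nothing since (L Y)_0 and (Y L)_0 have the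
    same residue. Writing r as the projection onto degrees >= 0 minus
    (1 + P_0) / 2, the terms <L X, L Y> and <X L, Y L> cancel by cyclicity. *)
Lemma GD_bracketE X Y be :
  be - hpow q n be = (L ** X) 0 - (X ** L) 0 ->
  GD_bracket q u X Y = GD_form X be Y.
Proof.
move=> beE; rewrite /GD_bracket /GD_form.
set a := (L ** X) 0 in beE *; set b := (X ** L) 0 in beE *.
set a' := (L ** Y) 0; set b' := (Y ** L) 0.
have ab : residue a = residue b by exact: residue_monicC.
have ab' : residue a' = residue b' by exact: residue_monicC.
have [ga gaM gaE] := inv_1mhE (L ** X); have [gb gbM gbE] := inv_1mhE (X ** L).
rewrite -/a in gaE; rewrite -/b -ab in gbE; set al := lcst (residue a) in gaE gbE.
pose d := ga - gb - be.
have dE : d = lcst (residue d).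
  apply: (hpow_fixed q_inf n_neq0); apply/eqP; rewrite eq_sym -subr_eq0 /d.
  rewrite !raddfB /=; apply/eqP.
  transitivity ((ga - hpow q n ga) - (gb - hpow q n gb) - (be - hpow q n be)).
    by ring.
  by rewrite gaE gbE beE; ring.
have trA := qpair_monic_cycle X Y.
have P00E A : P00 A = mono 0 (lcst (residue (A 0))).
  by rewrite /P00 /qcst /qTr /Pzero coef_part eqxx.
rewrite /GD11 /GD12 /GD21 /GD22 gaM gbM !hpow_qpdo_mono !P00E -/a -/b.
rewrite /r_scalar !(qpairDl, qpairNl, qpairZl, qpair_mono0, qpair_nonneg)//.
rewrite -/a -/b -/a' -/b' -ab -/al.
have := qpair_parts q (L ** X) (L ** Y); have := qpair_parts q (X ** L) (Y ** L).
rewrite -trA -/a -/b -/a' -/b'.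
have hx (x : laurent C) : hpow q n x = x - (x - hpow q n x) by ring.
rewrite (hx ga) (hx gb) (hx be).
have gaD : ga = gb + be + lcst (residue d) by rewrite -dE /d; ring.
have alM w : residue (al * w) = residue a * residue w by exact: residue_lcstM.
have dM w : residue (lcst (residue d) * w) = residue d * residue w by exact: residue_lcstM.
move: (residue d) gaD dM => kd gaD dM.
clearbody al; clear d dE; clearbody a b a' b'.
rewrite gaE gbE beE gaD => E2 E1.
exact: (GD_tail_identity _ _ alM dM ab' E2 E1).
Qed.

Lemma GD_formDl X1 be1 X2 be2 Y :
  GD_form (X1 + X2) (be1 + be2) Y = GD_form X1 be1 Y + GD_form X2 be2 Y.
Proof.
have hD : hpow q n (be1 + be2) = hpow q n be1 + hpow q n be2 by exact: raddfD.
rewrite /GD_form hD !(qmulDr, qmulDl) !partD !qpairDl !mulrDl !residueD.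
exact: add_four_terms.
Qed.

Lemma GD_formDr X be Y1 Y2 :
  GD_form X be (Y1 + Y2) = GD_form X be Y1 + GD_form X be Y2.
Proof.
rewrite /GD_form !(qmulDr, qmulDl) !qpairDr !qcoefD !mulrDr !residueD.
exact: add_four_terms.
Qed.

(** The ambiguity of a differential: pairing with u D^j for 0 <= j < n detects
    only the coefficients in degrees - (n - 1), ..., 0. *)
Definition far X := forall i : int, - (n : int) < i <= 0 -> X i = 0.

Lemma far_split X : far X -> let X1 := Ppos X in let X2 := part (fun i => i <= 0) X in
  [/\ X = X1 + X2,
      [/\ forall k, k <= 0 -> (L ** X1) k = 0 & forall k, k <= 0 -> (X1 ** L) k = 0],
      [/\ forall k, 0 < k -> (L ** X2) k = 0 & forall k, 0 < k -> (X2 ** L) k = 0],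
      (L ** X2) 0 = hpow q n (X (- (n : int))) &
      (X2 ** L) 0 = X (- (n : int))].
Proof.
move=> farX X1 X2.
have X1_0 i : i < 1 -> X1 i = 0 by move=> i1; rewrite coef_part; case: ifP => //; lia.
have X2_0 i : - (n : int) < i -> X2 i = 0.
  by move=> ni; rewrite coef_part; case: ifP => // i0; rewrite farX// ni.
have X2n : X2 (- (n : int)) = X (- (n : int)).
  by rewrite coef_part; case: ifP => //; lia.
split.
- apply: eq_series => k; rewrite qcoefD !coef_part.
  by case: ltP; rewrite ?addr0 ?add0r.
- split=> k k0.
    by apply: (qmul_bot _ (@monic_op_lt0 _ _ u) X1_0); lia.
  by apply: (qmul_bot _ X1_0 (@monic_op_lt0 _ _ u)); lia.
- split=> k k0.
    by rewrite (qmul_top _ (@monic_op_gt _ _ u) X2_0) ?gt_eqF//; lia.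
  by rewrite (qmul_top _ X2_0 (@monic_op_gt _ _ u)) ?gt_eqF//; lia.
- rewrite (qmul_top _ (@monic_op_gt _ _ u) X2_0); last by lia.
  by rewrite subrr eqxx monic_op_n mul1r X2n.
- rewrite (qmul_top _ X2_0 (@monic_op_gt _ _ u)); last by lia.
  by rewrite addNr eqxx monic_op_n hpow1 mulr1.
Qed.

Lemma part_all (P : pred int) X : (forall k, ~~ P k -> X k = 0) -> part P X = X.
Proof.
move=> PX; apply: eq_series => k; rewrite coef_part.
by case: ifP => // /negbT /PX.
Qed.

Lemma part_none (P : pred int) X : (forall k, P k -> X k = 0) -> part P X = 0.
Proof.
move=> PX; apply: eq_series => k; rewrite coef_part.
by case: ifP => // /PX.
Qed.

Lemma part_ge_mono X : (forall k, 0 < k -> X k = 0) ->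
  part (fun i => 0 <= i) X = mono 0 (X 0).
Proof.
move=> X0; apply: eq_series => k; rewrite coef_part coef_mono.
by case: ltgtP => // [/X0|->].
Qed.

(** Positive degrees give Tr (L X L Y) twice, with opposite signs. In degrees
    at most - n only x = X_(-n) matters: (L X)_0 = h^n x and (X L)_0 = x, so
    - x solves the difference equation and cancels the remaining terms. *)
Lemma GD_form_far_l X Y : far X -> GD_form X (- X (- (n : int))) Y = 0.
Proof.
move=> /far_split[]; set X1 := Ppos X; set X2 := part _ X.
move=> XE [LX1 X1L] [LX2 X2L] LX20 X2L0.
have LX2m : part (fun i => 0 <= i) (L ** X2) = mono 0 (hpow q n (X (- (n : int)))).
  by rewrite part_ge_mono// LX20.
have X2Lm : part (fun i => 0 <= i) (X2 ** L) = mono 0 (X (- (n : int))).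
  by rewrite part_ge_mono// X2L0.
have LX1m : part (fun i => 0 <= i) (L ** X1) = L ** X1.
  by apply: part_all => k; rewrite -ltNge => k0; rewrite LX1// ltW.
have X1Lm : part (fun i => 0 <= i) (X1 ** L) = X1 ** L.
  by apply: part_all => k; rewrite -ltNge => k0; rewrite X1L// ltW.
rewrite /GD_form {1 2}XE qmulDr qmulDl !partD LX1m X1Lm LX2m X2Lm.
rewrite !qpairDl !qpair_mono0 qpair_monic_cycle raddfN !mulNr !residueN.
ring.
Qed.

(** For the part of Y in degrees at most - n the nonpositive parts of L Y and
    Y L are the full products, which cancel by cyclicity, and
    (L Y)_0 = h^n ((Y L)_0); positive degrees are not seen at all. *)
Lemma GD_form_far_r X be Y : far Y -> GD_form X be Y = 0.
Proof.
move=> /far_split[]; set Y1 := Ppos Y; set Y2 := part _ Y.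
move=> YE [LY1 Y1L] [LY2 Y2L] LY20 Y2L0.
have LYm : part (fun i => 0 <= - i) (L ** Y) = L ** Y2.
  rewrite YE qmulDr partD part_none ?add0r; last by move=> k k0; apply: LY1; lia.
  by apply: part_all => k k0; apply: LY2; lia.
have YLm : part (fun i => 0 <= - i) (Y ** L) = Y2 ** L.
  rewrite YE qmulDl partD part_none ?add0r; last by move=> k k0; apply: Y1L; lia.
  by apply: part_all => k k0; apply: Y2L; lia.
rewrite /GD_form !qpair_part// LYm YLm qpair_monic_cycle subrr add0r.
rewrite {1 2}YE qmulDr qmulDl !qcoefD LY1// Y1L// !add0r LY20 Y2L0.
by rewrite -hpowM// residue_hpow subrr.
Qed.

End GDFormula.

(** * Skew symmetry, and coefficients of the products with L *)

Arguments monic_op : simpl never.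

Section Skew.
Variables (C : numFieldType) (q : C) (n : nat) (u : 'rV[laurent C]_n).
Hypothesis q0 : q != 0.
Local Notation L := (monic_op u).
Local Notation "A ** B" := (qmul q A B) (at level 40).
Implicit Types X Y : qpdo C.

Lemma qpair_nonneg_sym A B :
  qpair q (part (fun i => 0 <= i) A) B + qpair q (part (fun i => 0 <= i) B) A
  = qpair q A B + residue (A 0 * B 0).
Proof.
have -> : qpair q (part (fun i => 0 <= i) B) A = qpair q (part (fun i => 0 <= - i) A) B.
  rewrite (qpair_part q0 (fun i => 0 <= i) B A).
  exact: (qpairC q0 B (part (fun i => 0 <= - i) A)).
have E : part (fun i => 0 <= i) A + part (fun i => 0 <= - i) A = A + mono 0 (A 0).
  apply: eq_series => k; rewrite !qcoefD !coef_part coef_mono oppr_ge0.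
  by case: ltgtP => [||->]; rewrite ?addr0 ?add0r.
transitivity (qpair q (part (fun i => 0 <= i) A + part (fun i => 0 <= - i) A) B).
  by rewrite qpairDl.
by rewrite E qpairDl qpair_mono0.
Qed.

(** The two sides differ by the residue of be be' - (h be) (h be'). *)
Lemma skew_tail_identity (R : comNzRingType) (res : {additive R -> C})
    (h : {additive R -> R}) (a b a' b' be be' : R) :
  (forall x y, res (h x * h y) = res (x * y)) ->
  be - h be = a - b -> be' - h be' = a' - b' ->
  res (h be * a') - res (be * b') + (res (h be' * a) - res (be' * b)) =
  res (b * b') - res (a * a').
Proof.
move=> hh E E'.
have {E} -> : a = be - h be + b by rewrite E subrK.
have {E'} -> : a' = be' - h be' + b' by rewrite E' subrK.
rewrite -!raddfB -raddfD; apply/eqP; rewrite -subr_eq0 -raddfB; apply/eqP.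
transitivity (res (be * be' - h be * h be')); first by congr (res _); ring.
by rewrite raddfB hh subrr.
Qed.

(** Symmetrizing the quadratic terms leaves the products of the constant
    coefficients, the full traces cancelling by cyclicity. *)
Lemma GD_form_skew X be Y be' :
  be - hpow q n be = (L ** X) 0 - (X ** L) 0 ->
  be' - hpow q n be' = (L ** Y) 0 - (Y ** L) 0 ->
  GD_form q u X be Y = - GD_form q u Y be' X.
Proof.
move=> E E'; apply/eqP; rewrite -subr_eq0 opprK /GD_form addrACA; apply/eqP.
have hh x y : residue (hpow q n x * hpow q n y) = residue (x * y).
  by rewrite -hpowM// residue_hpow.
rewrite (skew_tail_identity hh E E').
have gen (k1 k2 k3 k4 p r1 r2 : C) : k1 + k3 = p + r1 -> k2 + k4 = p + r2 ->
    k1 - k2 + (k3 - k4) + (r2 - r1) = 0.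
  by move=> /(canRL (addrK _)) -> /(canRL (addrK _)) ->; ring.
have E1 := qpair_nonneg_sym (L ** X) (L ** Y).
have E2 := qpair_nonneg_sym (X ** L) (Y ** L).
rewrite -(qpair_monic_cycle u q0 X Y) in E2.
exact: gen E1 E2.
Qed.

End Skew.

Section Core.
Variables (C : numFieldType) (q : C) (n : nat) (u : 'rV[laurent C]_n).
Local Notation L := (monic_op u).
Local Notation "A ** B" := (qmul q A B) (at level 40).
Implicit Types X Y : qpdo C.

Definition core X := forall i : int, ~~ (- (n : int) < i <= 0) -> X i = 0.

(** A differential without coefficients outside degrees - (n - 1), ..., 0 is
    X = sum_j D^-j xi_j, with coefficients on the right; this is xi_j. *)
Definition dual_coef X (j : nat) : laurent C := hpow q j (X (- (j : int))).

(** Partial sums of the coefficients of X L. Up to dilations, the full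
    coefficients appear in row 0 and column 0
    ([coef_core_mul_ge0], [coef_core_mul_le0]). *)
Definition hankel X (i j : nat) : laurent C :=
  \sum_(k < n) hpow q (- (k : int)) (dual_coef X (i + k) * L (j + k)%N).

(** The coefficient of D^j in (L X)_(<= 0) L, when j >= 0. *)
Definition hankel_comb X (j : nat) : laurent C := \sum_(k < n) L k * hankel X k j.

Lemma dual_coef_ge X j : core X -> (n <= j)%N -> dual_coef X j = 0.
Proof. by move=> Xc nj; rewrite /dual_coef Xc ?raddf0//; lia. Qed.

Lemma hankel_ge X i j : core X -> (n <= i)%N -> hankel X i j = 0.
Proof.
move=> Xc ni; rewrite /hankel big1// => k _.
by rewrite dual_coef_ge ?mul0r ?raddf0//; lia.
Qed.

Lemma sum_shift (V : zmodType) (G : nat -> V) (i : nat) :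
  (forall a, (n <= a)%N -> G a = 0) ->
  \sum_(a < n) (if (a < i)%N then 0 else G a) = \sum_(k < n) G (i + k)%N.
Proof.
move=> G0; transitivity (\sum_(a < n + i) (if (a < i)%N then 0 else G a)).
  rewrite big_split_ord /= [X in _ + X]big1 ?addr0// => a _.
  by rewrite G0 ?if_same//; lia.
rewrite addnC big_split_ord /= big1 ?add0r => [|a _]; last by rewrite ltn_ord.
by apply: eq_bigr => k _; rewrite ltnNge leq_addr.
Qed.

Hypothesis q0 : q != 0.

Lemma dual_coefK X (j : nat) : hpow q (- (j : int)) (dual_coef X j) = X (- (j : int)).
Proof. by rewrite /dual_coef hpowK. Qed.

Lemma coef_core_mul X (k : int) : core X ->
  (X ** L) k = \sum_(a < n) hpow q (- (a : int)) (dual_coef X a * L (k + a)).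
Proof.
move=> Xc; rewrite (@coef_qmul _ _ _ _ _ [seq - Posz a | a <- iota 0 n]).
- rewrite big_map -{1}[n]subn0 -/(index_iota 0 n) big_mkord; apply: eq_bigr => a _.
  by rewrite hpowM// dual_coefK opprK.
- by rewrite map_inj_uniq ?iota_uniq// => a b /oppr_inj [].
- move=> i inr; rewrite Xc ?mul0r//; apply: contra inr => /andP[ni i0].
  by apply/mapP; exists (absz i); [rewrite mem_iota; lia|lia].
Qed.

Lemma coef_mul_core X (k : int) : core X ->
  (L ** X) k = \sum_(a < n) L (k + a) * hpow q k (dual_coef X a).
Proof.
move=> Xc; rewrite (@coef_qmul _ _ _ _ _ [seq k + Posz a | a <- iota 0 n]).
- rewrite big_map -{1}[n]subn0 -/(index_iota 0 n) big_mkord; apply: eq_bigr => a _.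
  congr (_ * _); rewrite /dual_coef hpowD//; congr (hpow _ _ (X _)); lia.
- by rewrite map_inj_uniq ?iota_uniq// => a b /addrI [].
- move=> i inr; rewrite Xc ?raddf0 ?mulr0//; apply: contra inr => /andP[ni i0].
  by apply/mapP; exists (absz (i - k)); [rewrite mem_iota; lia|lia].
Qed.

Lemma coef_core_mul_ge0 X (i : nat) : core X -> (X ** L) i = hankel X 0 i.
Proof. by move=> Xc; rewrite coef_core_mul. Qed.

Lemma coef_core_mul_le0 X (i : nat) : core X ->
  (X ** L) (- (i : int)) = hpow q (- (i : int)) (hankel X i 0).
Proof.
move=> Xc; rewrite coef_core_mul// /hankel [RHS]raddf_sum.
transitivity (\sum_(a < n) (if (a < i)%N then 0 else
    hpow q (- (a : int)) (dual_coef X a * L (a - i)%N))).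
  apply: eq_bigr => a _; case: ltnP => ai.
    rewrite monic_op_lt0; last by lia.
    by rewrite mulr0 raddf0.
  by congr (hpow _ _ (_ * L _)); lia.
rewrite (sum_shift (G := fun a => hpow q (- (a : int)) (dual_coef X a * L (a - i)%N))).
  apply: eq_bigr => k _; rewrite [RHS]hpowD// addKn.
  by congr (hpow _ _ _); lia.
by move=> a na; rewrite dual_coef_ge ?mul0r ?raddf0.
Qed.

Lemma coef_mul_core_le0 X (m : nat) : core X ->
  (L ** X) (- (m : int)) = \sum_(k < n) L k * hpow q (- (m : int)) (dual_coef X (m + k)).
Proof.
move=> Xc; rewrite coef_mul_core//.
transitivity (\sum_(a < n) (if (a < m)%N then 0 else
    L (a - m)%N * hpow q (- (m : int)) (dual_coef X a))).
  apply: eq_bigr => a _; case: ltnP => am.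
    rewrite monic_op_lt0; last by lia.
    by rewrite mul0r.
  by have -> : - (m : int) + a = (a - m)%N by lia.
rewrite (sum_shift (G := fun a => L (a - m)%N * hpow q (- (m : int)) (dual_coef X a))).
  by apply: eq_bigr => k _; rewrite addKn.
by move=> a na; rewrite dual_coef_ge ?raddf0 ?mulr0.
Qed.

Lemma qpair_nonneg_nat (A B : qpdo C) : (forall i : nat, (n <= i)%N -> B (- (i : int)) = 0) ->
  qpair q (part (fun i => 0 <= i) A) B =
    \sum_(i < n) residue (A i * hpow q i (B (- (i : int)))).
Proof.
move=> B0; rewrite (@qpair_seq _ _ _ _ [seq Posz a | a <- iota 0 n]).
- by rewrite big_map -{1}[n]subn0 -/(index_iota 0 n) big_mkord; apply: eq_bigr.
- by rewrite map_inj_uniq ?iota_uniq// => a b [].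
- move=> i inr; rewrite coef_part; case: ifP => i0; last by rewrite mul0r.
  have -> : i = absz i by lia.
  rewrite B0 ?raddf0 ?mulr0//.
  case: ltnP => // iln; case/negP: inr; apply/mapP; exists (absz i); last by lia.
  by rewrite mem_iota; lia.
Qed.

Lemma qpair_core_XL X Y : core X -> core Y ->
  qpair q (part (fun i => 0 <= i) (X ** L)) (Y ** L) =
    \sum_(i < n) residue (hankel X 0 i * hankel Y i 0).
Proof.
move=> Xc Yc; rewrite qpair_nonneg_nat => [|i ni].
  apply: eq_bigr => i _; rewrite coef_core_mul_ge0// coef_core_mul_le0//.
  by rewrite hpowVK.
by rewrite coef_core_mul_le0// hankel_ge ?raddf0.
Qed.

(** The coefficient of D^-m in L Y involves the terms L_k xi_(k+m) of Y, that
    of D^m in L X the terms L_(j+m) xi_j of X; undoing h^m under the residue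
    and summing over m first recombines L_k and xi_(k+m) L_(j+m) into
    [hankel_comb]. *)
Lemma qpair_core_LX X Y : core X -> core Y ->
  qpair q (part (fun i => 0 <= i) (L ** X)) (L ** Y) =
    \sum_(j < n) residue (dual_coef X j * hankel_comb Y j).
Proof.
move=> Xc Yc; rewrite qpair_nonneg_nat => [|i ni]; last first.
  rewrite coef_mul_core_le0// big1// => k _.
  by rewrite dual_coef_ge ?raddf0 ?mulr0//; lia.
transitivity (\sum_(m < n) \sum_(j < n) \sum_(k < n)
    residue (dual_coef X j * (L k * hpow q (- (m : int)) (dual_coef Y (k + m) * L (j + m)%N)))).
  apply: eq_bigr => m _; rewrite coef_mul_core// coef_mul_core_le0//.
  rewrite raddf_sum mulr_suml raddf_sum; apply: eq_bigr => j _ /=.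
  rewrite mulr_sumr raddf_sum; apply: eq_bigr => k _ /=.
  rewrite -[RHS](residue_hpow q m) !hpowM// !hpowVK//.
  rewrite (addnC k) (addnC j) -PoszD; congr residue; ring.
rewrite exchange_big; apply: eq_bigr => j _ /=.
rewrite /hankel_comb mulr_sumr raddf_sum exchange_big; apply: eq_bigr => k _ /=.
rewrite /hankel !mulr_sumr raddf_sum; apply: eq_bigr => m _ /=.
by rewrite mulrA.
Qed.

End Core.

(** * The matrix bracket at the canonical gradient *)

Section CompanionProducts.
Variables (C : fieldType) (n' : nat) (u : 'rV[laurent C]_n'.+1).
Local Notation n := n'.+1.
Local Notation LM := 'M[laurent C]_n.

Lemma companion_mulE (B : LM) i j :
  (companion u *m B) i j =
    if i == ord_max then - \sum_k u 0 k * B k j else B (inord i.+1) j.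
Proof.
rewrite mxE; case: eqP => [->|/eqP im].
  rewrite -sumrN; apply: eq_bigr => k _; rewrite mxE eqxx; exact: mulNr.
have lt_i : (i.+1 < n)%N.
  by have := ltn_ord i; rewrite ltnS leq_eqVlt => /orP[/eqP in'|//]; case/eqP: im; exact: val_inj.
rewrite (bigD1 (inord i.+1))//= mxE eqn_leq [(n <= _)%N]leqNgt lt_i andbF inordK// eqxx.
rewrite [X in X + _]mul1r big1 ?addr0// => k ki.
rewrite mxE eqn_leq [(n <= _)%N]leqNgt lt_i andbF.
case: eqP => [ke|_]; last exact: mul0r.
by case/eqP: ki; apply/val_inj; rewrite /= inordK.
Qed.

Lemma mul_companionE (B : LM) i j :
  (B *m companion u) i j =
    (if j == 0 then 0 else B i (inord j.-1)) - B i ord_max * u 0 j.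
Proof.
rewrite mxE (bigD1 ord_max)//= mxE eqxx addrC; congr (_ + _); last exact: mulrN.
have companion0 k : k != ord_max -> companion u k j = ((j : nat) == k.+1)%:R.
  move=> km; rewrite mxE; case: eqP => // kn.
  by case/eqP: km; apply/val_inj; case: kn.
case: eqP => [j0|/eqP j0].
  by rewrite big1// => k km; rewrite companion0// j0; exact: mulr0.
have j_gt0 : (0 < j)%N by rewrite lt0n; apply: contra j0 => /eqP j0; apply/eqP/val_inj.
have j1 : (j.-1 < n)%N by exact: leq_ltn_trans (leq_pred _) (ltn_ord j).
have j1m : inord j.-1 != ord_max :> 'I_n.
  rewrite -val_eqE /= inordK// neq_ltn; apply/orP; left.
  by rewrite -ltnS prednK// ltn_ord.
rewrite (bigD1 (inord j.-1))//= companion0// inordK// prednK// eqxx.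
rewrite [X in X + _]mulr1 big1 ?addr0// => k /andP[km kj].
rewrite companion0//; case: eqP => [jk|_]; last exact: mulr0.
by case/eqP: kj; apply/val_inj; rewrite /= inordK// jk.
Qed.

End CompanionProducts.

Section ReducedForm.
Variables (C : numFieldType) (q : C) (n' : nat) (u : 'rV[laurent C]_n'.+1).
Hypothesis q0 : q != 0.
Local Notation n := n'.+1.
Local Notation LM := 'M[laurent C]_n.
Local Notation A := (companion u).
Implicit Types X Y B : LM.

(** Twice the bracket of [S_bracketE] in terms of diagonal solutions B and B'
    of the cyclic difference equation ([mxpair_cayley]). *)
Definition reduced_form X1 X2 B Y1 Y2 B' : C :=
  mxpair (theta q B) B' - mxpair B (theta q B') + (mxpair X1 Y2 - mxpair X2 Y1).

Lemma reduced_form_skew X1 X2 B Y1 Y2 B' :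
  reduced_form X1 X2 B Y1 Y2 B' = - reduced_form Y1 Y2 B' X1 X2 B.
Proof.
rewrite /reduced_form [mxpair (theta q B) B']mxpairC [mxpair B (theta q B')]mxpairC.
by rewrite [mxpair X1 Y2]mxpairC [mxpair X2 Y1]mxpairC opprD !opprB.
Qed.

Lemma reduced_formDl X1 X2 B X1' X2' B1 Y1 Y2 B' :
  reduced_form (X1 + X1') (X2 + X2') (B + B1) Y1 Y2 B' =
  reduced_form X1 X2 B Y1 Y2 B' + reduced_form X1' X2' B1 Y1 Y2 B'.
Proof.
rewrite /reduced_form thetaD !mxpairDl.
exact: add_four_terms.
Qed.

Lemma reduced_formDr X1 X2 B X1' X2' B1 Y1 Y2 B' :
  reduced_form Y1 Y2 B' (X1 + X1') (X2 + X2') (B + B1) =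
  reduced_form Y1 Y2 B' X1 X2 B + reduced_form Y1 Y2 B' X1' X2' B1.
Proof. by rewrite reduced_form_skew reduced_formDl opprD -!reduced_form_skew. Qed.

Definition strictly_lower (M : LM) := forall i j : 'I_n, (i <= j)%N -> M i j = 0.

Lemma strictly_lower_mul (la : LM) : strictly_lower la ->
  let L1 := mxhpow q (-1) (A *m la) in let L2 := la *m A in
  [/\ is_lower L1, is_lower L2 & theta q (mxPzero L1) = mxPzero L2].
Proof.
move=> laL L1 L2.
have L2E i j : L2 i j = if j == 0 then 0 else la i (inord j.-1).
  rewrite /L2 mul_companionE [la i ord_max]laL ?mul0r ?subr0//.
  by rewrite -ltnS; exact: ltn_ord.
have j1 (j : 'I_n) : (j.-1 < n)%N by exact: leq_ltn_trans (leq_pred _) (ltn_ord j).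
split.
- move=> i j ij; rewrite mxE companion_mulE.
  rewrite ifF; last by apply/negP => /eqP ie; have := ltn_ord j; rewrite ie /= in ij; lia.
  rewrite laL ?raddf0// inordK//.
  by have := ltn_ord j; lia.
- move=> i j ij; rewrite L2E; case: eqP => // _.
  by rewrite laL// inordK//; lia.
- apply/matrixP => i j; rewrite thetaE [RHS]mxE; case: eqP => // <-.
  rewrite mxE eqxx mxE companion_mulE L2E.
  case: i => -[|i] lt_i.
    have -> : Ordinal lt_i = ord0 by exact: val_inj.
    rewrite ord_pred0 !eqxx big1 ?oppr0 ?raddf0// => k _.
    by rewrite laL ?mulr0// -ltnS; exact: ltn_ord.
  rewrite ord_predS hpowVK// -!val_eqE /= ltn_eqF//.
  by congr (la _ _); apply/val_inj; rewrite /= inordK// ltnW.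
Qed.

(** Strictly lower matrices are the gradients, at points of [Yn], of
    functionals vanishing on [Yn]. For them [theta] maps the
    diagonal of L1 to that of L2, so that the diagonal of L1 solves the
    difference equation, and the form becomes
    tr (A la A dg) - tr (la A dg A) = 0. *)
Lemma reduced_form_strictly_lower la dg B' : strictly_lower la ->
  let L1 := mxhpow q (-1) (A *m la) in let L2 := la *m A in
  let Y1 := mxhpow q (-1) (A *m dg) in let Y2 := dg *m A in
  is_lower (Y1 - Y2) -> mxPzero B' = B' -> B' - theta q B' = mxPzero (Y1 - Y2) ->
  reduced_form L1 L2 (mxPzero L1) Y1 Y2 B' = 0.
Proof.
move=> laL L1 L2 Y1 Y2 Wl Bd BE.
have [L1l L2l th] := strictly_lower_mul laL; rewrite -/L1 -/L2 in L1l L2l th.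
have E1 : mxpair L1 Y1 = mxpair L2 Y2.
  apply: etrans (mxpair_hpow q0 _ _ _) _.
  by rewrite mxpairA mxpairC mxpairA /L2 /Y2 mxpairA -mulmxA.
have E2 : mxpair (theta q (mxPzero L1)) B' - mxpair (mxPzero L1) (theta q B') =
    mxpair (L1 + L2) (Y1 - Y2).
  have L12 : is_lower (L1 + L2) by move=> i j ij; rewrite mxE L1l// L2l// addr0.
  rewrite (mxpair_lower L12 Wl) -BE mxPzeroD -th.
  have E3 := mxpair_theta q0 B' (mxPzero_id L1).
  rewrite mxpairBr !mxpairDl E3.
  have gen (x y z : C) : y - z = x + y - (z + x) by ring.
  exact: gen.
rewrite /reduced_form E2 mxpairBr !mxpairDl E1.
have gen (x y z : C) : x + y - (z + x) + (z - y) = 0 by ring.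
exact: gen.
Qed.

End ReducedForm.

Section CanonicalGradient.
Variables (C : numFieldType) (q : C) (n' : nat) (u : 'rV[laurent C]_n'.+1).
Hypothesis q0 : q != 0.
Local Notation n := n'.+1.
Local Notation LM := 'M[laurent C]_n.
Local Notation A := (companion u).
Local Notation L := (monic_op u).
Local Notation "A ** B" := (qmul q A B) (at level 40).
Local Notation e := (hankel q u).
Local Notation G := (hankel_comb q u).
Implicit Types X Y : qpdo C.

Lemma hankel_rec X (i j : nat) : core n X ->
  e X i j = dual_coef q X i * L j + hpow q (-1) (e X i.+1 j.+1).
Proof.
move=> Xc; rewrite /hankel big_ord_recl hpow0 !addn0; congr (_ + _).
rewrite [in RHS]big_ord_recr /= (dual_coef_ge q Xc) ?mul0r; last by lia.
rewrite [hpow _ _ 0]raddf0 addr0 raddf_sum; apply: eq_bigr => k _ /=.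
rewrite hpowD// /bump /= add1n !addSnnS; congr (hpow _ _ _); lia.
Qed.

Lemma hankel_n X (i : nat) : core n X -> e X i n = dual_coef q X i.
Proof.
move=> Xc; rewrite /hankel big_ord_recl hpow0 !addn0 monic_op_n mulr1.
rewrite big1 ?addr0// => k _; rewrite monic_op_gt ?mulr0 ?raddf0//.
by rewrite lift0; lia.
Qed.


(** On and above the diagonal this is the gradient of any lift
    ([lift_gradient_upper]). The same formula below the diagonal makes the
    products with the companion matrix on both sides agree up to a last row
    and a first column. *)
Definition canonical_grad X : LM := \matrix_(i, j) - e X i j.+1.
Definition hankel_part X : LM := \matrix_(i, j) hpow q (-1) (e X i.+1 j.+1).
Definition last_row_part X : LM :=
  \matrix_(i, j) if i == ord_max then hpow q (-1) (G X j.+1) else 0.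
Definition first_col_part X : LM := \matrix_(i, j) if j == 0 then e X i 0 else 0.

Lemma canonical_gradE X i j : canonical_grad X i j = - e X i j.+1. Proof. exact: mxE. Qed.
Lemma hankel_partE X i j : hankel_part X i j = hpow q (-1) (e X i.+1 j.+1).
Proof. exact: mxE. Qed.
Lemma last_row_partE X i j :
  last_row_part X i j = if i == ord_max then hpow q (-1) (G X j.+1) else 0.
Proof. exact: mxE. Qed.
Lemma first_col_partE X i j : first_col_part X i j = if j == 0 then e X i 0 else 0.
Proof. exact: mxE. Qed.

Lemma companion_canonical_grad X : core n X ->
  mxhpow q (-1) (A *m canonical_grad X) = - hankel_part X + last_row_part X.
Proof.
move=> Xc; apply/matrixP => i j; rewrite mxE companion_mulE [RHS]mxE [in RHS]mxE.
rewrite hankel_partE last_row_partE.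
case: eqP => [->|/eqP im].
  rewrite (hankel_ge q u _ Xc)// raddf0 oppr0 add0r; congr (hpow _ _ _).
  rewrite -sumrN; apply: eq_bigr => k _.
  by rewrite canonical_gradE mulrN opprK monic_op_lt.
have lt_i : (i.+1 < n)%N.
  by have := ltn_ord i; rewrite ltnS leq_eqVlt => /orP[/eqP in'|//]; case/eqP: im; exact: val_inj.
by rewrite addr0 canonical_gradE hpowN inordK.
Qed.

Lemma canonical_grad_companion X : core n X ->
  canonical_grad X *m A = - hankel_part X + first_col_part X.
Proof.
move=> Xc; apply/matrixP => i j; rewrite mul_companionE [RHS]mxE [in RHS]mxE.
rewrite hankel_partE first_col_partE [canonical_grad X i ord_max]canonical_gradE hankel_n//.
rewrite -monic_op_lt mulNr opprK.
case: eqP => [->|/eqP j0].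
  by rewrite add0r (hankel_rec i 0 Xc) [RHS]addrC addrK.
have j_gt0 : (0 < j)%N by rewrite lt0n; apply: contra j0 => /eqP j0; apply/eqP/val_inj.
have j1 : (j.-1 < n)%N by exact: leq_ltn_trans (leq_pred _) (ltn_ord j).
rewrite canonical_gradE (inordK j1) prednK//.
by rewrite (hankel_rec i j Xc) opprD addrAC addNr add0r addr0.
Qed.

Lemma canonical_grad_sub X : core n X ->
  mxhpow q (-1) (A *m canonical_grad X) - canonical_grad X *m A =
    last_row_part X - first_col_part X.
Proof.
move=> Xc; rewrite (companion_canonical_grad Xc) (canonical_grad_companion Xc).
by rewrite opprD addrACA subrr add0r.
Qed.

Lemma is_lower_row_col X : is_lower (last_row_part X - first_col_part X).
Proof.
move=> i j ij; rewrite mx_entryB last_row_partE first_col_partE.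
case: eqP => [ie|_]; first by have := ltn_ord j; rewrite ie /= in ij; lia.
case: eqP => [je|_]; last by rewrite subr0.
by move: ij; rewrite je.
Qed.

(** With a = (L X)_0 and b = (X L)_0, the equation to solve has right-hand side
    diag (- b, 0, ..., 0, h^-1 a). Along the cycle the solution propagates as
    h^i be, and the last entry jumps by h^-1 a; the cycle closes because
    be - h^n be = a - b. *)
Definition cyclic_sol (be : laurent C) X : LM :=
  \matrix_(i, j) if i == j then
    hpow q i be + (if i == ord_max then hpow q (-1) (G X n) else 0) else 0.

Lemma cyclic_solE be X (i : 'I_n) : cyclic_sol be X i i =
  hpow q i be + (if i == ord_max then hpow q (-1) (G X n) else 0).
Proof. by rewrite mxE eqxx. Qed.

Lemma mxPzero_cyclic_sol be X : mxPzero (cyclic_sol be X) = cyclic_sol be X.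
Proof. by apply/matrixP => i j; rewrite !mxE; case: eqP. Qed.

Lemma coef_LX0 X : core n X -> (L ** X) 0 = G X n.
Proof.
move=> Xc; rewrite coef_mul_core//; apply: eq_bigr => j _.
by rewrite hpow0 add0r hankel_n.
Qed.

Lemma coef_XL0 X : core n X -> (X ** L) 0 = e X 0 0.
Proof. by move=> Xc; rewrite (coef_core_mul_ge0 u q0 0 Xc). Qed.

Lemma cyclic_sol_theta be X : core n X ->
  be - hpow q n be = (L ** X) 0 - (X ** L) 0 ->
  cyclic_sol be X - theta q (cyclic_sol be X) = mxPzero (last_row_part X - first_col_part X).
Proof.
move=> Xc; rewrite coef_LX0// coef_XL0// => beE.
apply/matrixP => i j; rewrite mx_entryB thetaE [RHS]mxE.
case: eqP => [<-|/eqP ij]; last by rewrite mxE (negPf ij) subr0.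
rewrite !cyclic_solE mx_entryB last_row_partE first_col_partE.
case: i => -[|i] lt_i.
  have -> : Ordinal lt_i = ord0 by exact: val_inj.
  rewrite ord_pred0 !eqxx raddfD /= hpowVK// hpowD// hpow0.
  have -> : 1 + (n' : int) = n by lia.
  have gen (V : zmodType) (x y c a b : V) : x - y = a - b -> x + c - (y + a) = c - b.
    move=> E; rewrite opprD addrACA E [c - a]addrC addrACA.
    by rewrite subrr add0r addrC.
  rewrite (gen _ _ _ _ _ _ beE); congr (_ - _).
  case: eqP => // E; congr (hpow _ _ (G X _)).
  by move/(congr1 val): E => /= <-.
rewrite ord_predS subr0 -!val_eqE /= [(i == n')](@ltn_eqF i n')// addr0 hpowD//.
have -> : 1 + (i : int) = i.+1 by lia.
rewrite addrAC subrr add0r; case: eqP => // E.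
by congr (hpow _ _ (G X _)); rewrite E.
Qed.

(** The solution [cyclic_sol] without the jump in its last entry. *)
Definition orbit_diag (be : laurent C) : LM :=
  \matrix_(i, j) if i == j then hpow q i be else 0.

Lemma orbit_diagE be (i : 'I_n) : orbit_diag be i i = hpow q i be.
Proof. by rewrite mxE eqxx. Qed.

Lemma mxPzero_orbit_diag be : mxPzero (orbit_diag be) = orbit_diag be.
Proof. by apply/matrixP => i j; rewrite !mxE; case: eqP. Qed.

Lemma cyclic_sol_orbit_diag be X : cyclic_sol be X = orbit_diag be + mxPzero (last_row_part X).
Proof.
apply/matrixP => i j; rewrite [RHS]mxE [in RHS]mxE [mxPzero _ _ _]mxE mxE.
case: eqP => [<-|_]; last by rewrite addr0.
rewrite last_row_partE; case: eqP => // ->.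
by [].
Qed.

(** A last row times a first column has trace 0 unless n = 1, and then both
    matrices are diagonal. *)
Lemma mxpair_row_col X Y :
  mxpair (mxPzero (last_row_part X)) (first_col_part Y) =
  mxpair (last_row_part X) (first_col_part Y).
Proof.
rewrite mxpair_diag ?mxPzero_id// mxpairE; apply: eq_bigr => i _.
rewrite mxE eqxx (bigD1 i)//= big1 ?addr0// => j ji.
rewrite last_row_partE first_col_partE.
case: eqP => [ie|_]; last by rewrite mul0r raddf0.
case: eqP => [i0|_]; last by rewrite mulr0 raddf0.
by move: ji (ltn_ord j); rewrite -val_eqE /= i0; move: (congr1 val ie) => /=; rewrite i0 /=; lia.
Qed.

Lemma sum_ord_shift (V : zmodType) (F : nat -> V) : F n = 0 ->
  \sum_(i < n) F i.+1 = \sum_(i < n) F i - F 0%N.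
Proof.
move=> Fn; rewrite [in RHS]big_ord_recl big_ord_recr /= Fn addr0.
by rewrite [F 0%N + _]addrC addrK.
Qed.

(** The pairings of [hankel_part] with a last row and a first column are the
    sums of [qpair_core_LX] and [qpair_core_XL] with the terms of index 0 of
    the expansion missing; both omit the residue of xi_0 G_0. *)
Lemma GD_form_canonical X be Y : core n X -> core n Y ->
  mxpair (orbit_diag be) (last_row_part Y - first_col_part Y)
    + (mxpair (hankel_part X) (last_row_part Y) - mxpair (hankel_part X) (first_col_part Y)) =
  GD_form q u X be Y.
Proof.
move=> Xc Yc; rewrite /GD_form qpair_core_LX// qpair_core_XL//.
have -> : mxpair (orbit_diag be) (last_row_part Y - first_col_part Y) =
    residue (hpow q n be * (L ** Y) 0) - residue (be * (Y ** L) 0).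
  rewrite mxpair_diag ?mxPzero_orbit_diag// coef_LX0// coef_XL0//.
  transitivity (\sum_(i < n) residue (hpow q i be * last_row_part Y i i) -
      \sum_(i < n) residue (hpow q i be * first_col_part Y i i)).
    rewrite -sumrB; apply: eq_bigr => i _.
    by rewrite orbit_diagE mx_entryB mulrBr raddfB.
  congr (_ - _).
    rewrite (bigD1 ord_max)//= big1 ?addr0 => [|i im].
      rewrite last_row_partE eqxx -(residue_hpow q 1) hpowM// hpowVK// hpowD//.
    by rewrite last_row_partE (negPf im) mulr0 raddf0.
  rewrite (bigD1 ord0)//= big1 ?addr0 => [|i i0].
    by rewrite first_col_partE eqxx hpow0.
  by rewrite first_col_partE (negPf i0) mulr0 raddf0.
have -> : mxpair (hankel_part X) (last_row_part Y) =
    \sum_(i < n) residue (dual_coef q X i * G Y i) - residue (dual_coef q X 0 * G Y 0).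
  rewrite -(sum_ord_shift (F := fun i => residue (dual_coef q X i * G Y i))); last first.
    by rewrite (dual_coef_ge q Xc)// mul0r raddf0.
  rewrite mxpairE; apply: eq_bigr => i _.
  rewrite (bigD1 ord_max)//= big1 ?addr0 => [|j jm]; last first.
    by rewrite last_row_partE (negPf jm) mulr0 raddf0.
  rewrite hankel_partE last_row_partE eqxx hankel_n// -hpowM//; exact: residue_hpow.
have -> : mxpair (hankel_part X) (first_col_part Y) =
    \sum_(i < n) residue (e X 0 i * e Y i 0) - residue (dual_coef q X 0 * G Y 0).
  rewrite mxpairE (bigD1 ord0)//= [X in _ + X]big1 ?addr0 => [|i i0]; last first.
    by apply: big1 => j _; rewrite first_col_partE (negPf i0) mulr0 raddf0.
  rewrite /hankel_comb mulr_sumr raddf_sum -sumrB; apply: eq_bigr => j _.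
  rewrite hankel_partE first_col_partE eqxx (hankel_rec 0 j Xc).
  have gen (x y z w : laurent C) : y * w = (x * z + y) * w - x * (z * w) by ring.
  by rewrite {1}(gen (dual_coef q X 0) _ (L j)) raddfB.
have gen (a b c d f : C) : a - b + (c - f - (d - f)) = c - d + (a - b) by ring.
exact: gen.
Qed.

(** The terms quadratic in [hankel_part] cancel, and what is left is [GD_form]
    antisymmetrized in X and Y. *)
Lemma reduced_form_canonical X be Y be' : core n X -> core n Y ->
  be - hpow q n be = (L ** X) 0 - (X ** L) 0 ->
  be' - hpow q n be' = (L ** Y) 0 - (Y ** L) 0 ->
  reduced_form q (mxhpow q (-1) (A *m canonical_grad X)) (canonical_grad X *m A) (cyclic_sol be X)
             (mxhpow q (-1) (A *m canonical_grad Y)) (canonical_grad Y *m A) (cyclic_sol be' Y) =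
  2 * GD_form q u X be Y.
Proof.
move=> Xc Yc beE beE'.
rewrite !companion_canonical_grad// !canonical_grad_companion//.
have EX := cyclic_sol_theta Xc beE; have EY := cyclic_sol_theta Yc beE'.
have D1 : mxpair (theta q (cyclic_sol be X)) (cyclic_sol be' Y)
     - mxpair (cyclic_sol be X) (theta q (cyclic_sol be' Y)) =
   mxpair (cyclic_sol be X) (last_row_part Y - first_col_part Y)
   - mxpair (cyclic_sol be' Y) (last_row_part X - first_col_part X).
  rewrite -[mxpair _ (last_row_part Y - _)]mxpair_Pzero ?mxPzero_cyclic_sol// -EY.
  rewrite -[mxpair _ (last_row_part X - _)]mxpair_Pzero ?mxPzero_cyclic_sol// -EX.
  rewrite !mxpairBr [mxpair (cyclic_sol be' Y) (cyclic_sol _ _)]mxpairC.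
  rewrite [mxpair (cyclic_sol be' Y) _]mxpairC.
  have gen (a b c : C) : a - b = c - b - (c - a) by ring.
  exact: gen.
have H1 := GD_form_canonical be Xc Yc; have H2 := GD_form_canonical be' Yc Xc.
have S := GD_form_skew q0 beE beE'.
have R1 := mxpair_row_col X Y; have R2 := mxpair_row_col Y X.
have R3 : mxpair (mxPzero (last_row_part X)) (last_row_part Y) =
          mxpair (mxPzero (last_row_part Y)) (last_row_part X).
  rewrite -[LHS]mxpair_Pzero ?mxPzero_id// mxpairC mxpair_Pzero ?mxPzero_id//.
rewrite /reduced_form D1 !cyclic_sol_orbit_diag.
rewrite mulr_natl mulr2n {1}S -H1 -H2.
rewrite !(mxpairDl, mxpairDr, mxpairNl, mxpairNr) R1 R2 R3.
rewrite [mxpair (hankel_part Y) (last_row_part X)]mxpairC.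
rewrite [mxpair (hankel_part Y) (first_col_part X)]mxpairC.
rewrite [mxpair (first_col_part X) (last_row_part Y)]mxpairC.
move: (mxpair (orbit_diag be) (last_row_part Y)) (mxpair (orbit_diag be) (first_col_part Y)).
move: (mxpair (orbit_diag be') (last_row_part X)) (mxpair (orbit_diag be') (first_col_part X)).
move: (mxpair (hankel_part X) (hankel_part Y)) (mxpair (hankel_part X) (last_row_part Y)).
move: (mxpair (hankel_part X) (first_col_part Y)) (mxpair (last_row_part X) (hankel_part Y)).
move: (mxpair (first_col_part X) (hankel_part Y)) (mxpair (last_row_part Y) (last_row_part X)).
move: (mxpair (last_row_part X) (first_col_part Y)) (mxpair (last_row_part Y) (first_col_part X)).
move: (mxpair (mxPzero (last_row_part Y)) (last_row_part X)).
move=> *; ring.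
Qed.

End CanonicalGradient.

(** * Comparison of the two brackets *)

Section FarPart.
Variables (C : numFieldType) (q : C) (n : nat) (u : 'rV[laurent C]_n).
Hypothesis q0 : q != 0.
Hypothesis q_inf : forall k : int, k != 0 -> q ^ k != 1.
Hypothesis n_gt0 : (0 < n)%N.
Local Notation L := (monic_op u).
Local Notation "A ** B" := (qmul q A B) (at level 40).
Implicit Types X Y : qpdo C.

Definition core_part X : qpdo C := part (fun i => - (n : int) < i <= 0) X.

Lemma core_core_part X : core n (core_part X).
Proof. by move=> i ni; rewrite coef_part (negPf ni). Qed.

Lemma far_sub_core_part X : far n (X - core_part X).
Proof. by move=> i ni; rewrite qcoefB coef_part ni subrr. Qed.

Lemma far_solution X : far n X ->
  - X (- (n : int)) - hpow q n (- X (- (n : int))) = (L ** X) 0 - (X ** L) 0.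
Proof.
move=> /(far_split u q0 n_gt0)[XE [LX1 X1L] _ LX2 X2L].
rewrite [in RHS]XE qmulDr qmulDl !qcoefD LX1// X1L// LX2 X2L !add0r.
by rewrite hpowN opprK addrC.
Qed.

Lemma core_solution X : exists be : laurent C,
  be - hpow q n be = (L ** X) 0 - (X ** L) 0.
Proof.
exists (solve_1mh q n ((L ** X) 0 - (X ** L) 0)).
apply: solve_1mhP => //; first by case: n n_gt0.
by rewrite raddfB /= residue_monicC// subrr.
Qed.

Lemma GD_bracket_core X Y be :
  be - hpow q n be = (L ** core_part X) 0 - (core_part X ** L) 0 ->
  GD_bracket q u X Y = GD_form q u (core_part X) be (core_part Y).
Proof.
move=> beE.
have XE : X = core_part X + (X - core_part X) by rewrite addrC subrK.
have YE : Y = core_part Y + (Y - core_part Y) by rewrite addrC subrK.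
have farX := far_sub_core_part X; have farY := far_sub_core_part Y.
move: (X - core_part X) (Y - core_part Y) XE YE farX farY => X' Y' XE YE farX farY.
rewrite (@GD_bracketE _ _ _ u q0 q_inf n_gt0 X Y (be - X' (- (n : int)))).
  rewrite [in LHS]XE GD_formDl// GD_form_far_l// addr0 [in LHS]YE GD_formDr//.
  by rewrite (GD_form_far_r u q0 n_gt0 _ _ farY) addr0.
have hB (x y : laurent C) : x - y - hpow q n (x - y) = x - hpow q n x + (- y - hpow q n (- y)).
  by rewrite hpowN (raddfB (hpow q n)) /= opprD addrACA.
rewrite hB beE far_solution// [in RHS]XE qmulDr qmulDl !qcoefD.
by rewrite opprD addrACA.
Qed.

End FarPart.

Section Main.
Variables (C : numFieldType) (q : C) (n' : nat) (u : 'rV[laurent C]_n'.+1).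
Hypothesis q0 : q != 0.
Hypothesis q_inf : forall k : int, k != 0 -> q ^ k != 1.
Local Notation n := n'.+1.
Local Notation LM := 'M[laurent C]_n.
Local Notation A := (companion u).
Local Notation L := (monic_op u).
Local Notation "A ** B" := (qmul q A B) (at level 40).

(** Downward induction on the column: [lift_gradient_gauge] expresses column j
    through columns j + 1 and n - 1, in the same way as [hankel_rec]. *)
Lemma lift_gradient_upper phi f dphi df (i j : 'I_n) :
  is_lift q phi f -> is_differential q phi u dphi -> is_gradient f A df ->
  (i <= j)%N -> df i j = canonical_grad q u (core_part n dphi) i j.
Proof.
move=> fl dphiP dfP; set X := core_part n dphi.
have Xc : core n X by exact: core_core_part.
have last_col (k : 'I_n) : df k ord_max = - dual_coef q X k.
  rewrite (lift_gradient_last_col q0 k fl dphiP dfP) /dual_coef coef_part.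
  by case: ifP => //; have := ltn_ord k; lia.
have [m] : exists m, (n' - j <= m)%N by exists (n' - j)%N.
elim: m i j => [|m IHm] i j jm ij.
  have -> : j = ord_max by apply/val_inj; have := ltn_ord j; move: jm => /=; lia.
  by rewrite last_col canonical_gradE hankel_n.
have [jmax|jn'] := eqVneq j ord_max.
  by rewrite jmax last_col canonical_gradE hankel_n.
have lt_j : (j.+1 < n)%N.
  by have := ltn_ord j; rewrite ltnS leq_eqVlt => /orP[/eqP E|//]; case/eqP: jn'; exact: val_inj.
have lt_i : (i.+1 < n)%N by exact: leq_ltn_trans lt_j.
have := @lift_gradient_gauge _ _ _ q0 phi f A df (Ordinal lt_j) i fl dfP.
rewrite /= ltnS => /(_ ij); rewrite companion_mulE mul_companionE.
rewrite ifF; last by apply/negP => /eqP/(congr1 val)/= E; rewrite E ltnn in lt_i.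
have -> : inord (Ordinal lt_j).-1 = j by apply/val_inj; rewrite /= inordK.
rewrite (IHm (inord i.+1) (Ordinal lt_j)); last 2 first.
- by move: jm => /=; lia.
- by rewrite /= inordK.
rewrite last_col !canonical_gradE inordK// hpowN mulNr opprK -monic_op_lt /=.
rewrite (hankel_rec u q0 i j.+1 Xc) opprD => ->.
by rewrite [RHS]addrC addrK.
Qed.

(** Each gradient is the canonical one plus a strictly lower matrix, and the
    latter lies in the kernel of the skew form. *)
Lemma S_bracket_lift phi psi f g dphi dpsi df dg :
  is_lift q phi f -> is_lift q psi g ->
  is_differential q phi u dphi -> is_differential q psi u dpsi ->
  is_gradient f A df -> is_gradient g A dg ->
  S_bracket q A df dg = GD_bracket q u dphi dpsi.
Proof.
move=> fl gl dphiP dpsiP dfP dgP.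
set X := core_part n dphi; set Y := core_part n dpsi.
have Xc : core n X by exact: core_core_part.
have Yc : core n Y by exact: core_core_part.
have [be beE] := core_solution u q0 q_inf (ltn0Sn n') X.
have [be' beE'] := core_solution u q0 q_inf (ltn0Sn n') Y.
rewrite (GD_bracket_core q0 q_inf (ltn0Sn n') dpsi beE) -/Y.
have hD (M N : LM) : mxhpow q (-1) (M + N) = mxhpow q (-1) M + mxhpow q (-1) N.
  by exact: raddfD.
have lower_of phi' f' d : is_lift q phi' f' -> is_gradient f' A d ->
    is_lower (mxhpow q (-1) (A *m d) - d *m A).
  move=> fl' dP i j ij; rewrite mx_entryB [mxhpow _ _ _ _ _]mxE.
  by rewrite (lift_gradient_gauge q0 fl' dP ij) subrr.
have Zl := lower_of _ _ _ fl dfP; have Wl := lower_of _ _ _ gl dgP.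
have la_of phi' f' dphi' d : is_lift q phi' f' -> is_differential q phi' u dphi' ->
    is_gradient f' A d -> strictly_lower (d - canonical_grad q u (core_part n dphi')).
  move=> fl' dphiP' dP i j ij; rewrite mx_entryB.
  by rewrite (lift_gradient_upper fl' dphiP' dP ij) subrr.
have laP := la_of _ _ _ _ fl dphiP dfP; have muP := la_of _ _ _ _ gl dpsiP dgP.
have dfE : df = canonical_grad q u X + (df - canonical_grad q u X) by rewrite addrC subrK.
have dgE : dg = canonical_grad q u Y + (dg - canonical_grad q u Y) by rewrite addrC subrK.
rewrite -/X in laP; rewrite -/Y in muP.
move: (df - _) (dg - _) dfE dgE laP muP => la mu dfE dgE laP muP.
rewrite S_bracketE//.
set X1 := mxhpow q (-1) (A *m df) in Zl *; set X2 := df *m A in Zl *.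
set Y1 := mxhpow q (-1) (A *m dg) in Wl *; set Y2 := dg *m A in Wl *.
pose L1 := mxhpow q (-1) (A *m la); pose L2 := la *m A.
pose K1 := mxhpow q (-1) (A *m mu); pose K2 := mu *m A.
pose E1 := mxhpow q (-1) (A *m canonical_grad q u X); pose E2 := canonical_grad q u X *m A.
pose F1 := mxhpow q (-1) (A *m canonical_grad q u Y); pose F2 := canonical_grad q u Y *m A.
have X1E : X1 = E1 + L1 by rewrite /X1 dfE mulmxDr hD.
have X2E : X2 = E2 + L2 by rewrite /X2 dfE mulmxDl.
have Y1E : Y1 = F1 + K1 by rewrite /Y1 dgE mulmxDr hD.
have Y2E : Y2 = F2 + K2 by rewrite /Y2 dgE mulmxDl.
(* solutions of the difference equation for the canonical and the strictly
   lower contributions add up *)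
have sol_of (x1 x2 e1 e2 l1 l2 B : LM) : x1 = e1 + l1 -> x2 = e2 + l2 ->
    theta q (mxPzero l1) = mxPzero l2 -> B - theta q B = mxPzero (e1 - e2) ->
    (B + mxPzero l1) - theta q (B + mxPzero l1) = mxPzero (x1 - x2).
  move=> -> -> th BE; rewrite thetaD opprD addrACA BE th -mxPzeroB -mxPzeroD.
  by congr mxPzero; rewrite opprD addrACA.
have EE : cyclic_sol q u be X - theta q (cyclic_sol q u be X) = mxPzero (E1 - E2).
  apply: etrans (cyclic_sol_theta q0 Xc beE) _.
  by congr mxPzero; rewrite /E1 /E2 (canonical_grad_sub u q0 Xc).
have FE : cyclic_sol q u be' Y - theta q (cyclic_sol q u be' Y) = mxPzero (F1 - F2).
  apply: etrans (cyclic_sol_theta q0 Yc beE') _.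
  by congr mxPzero; rewrite /F1 /F2 (canonical_grad_sub u q0 Yc).
have [_ _ thL] := strictly_lower_mul u q0 laP.
have [_ _ thK] := strictly_lower_mul u q0 muP.
have BE := sol_of _ _ _ _ _ _ _ X1E X2E thL EE.
have BE' := sol_of _ _ _ _ _ _ _ Y1E Y2E thK FE.
pose B := cyclic_sol q u be X + mxPzero L1; pose B' := cyclic_sol q u be' Y + mxPzero K1.
have Bd : mxPzero B = B by rewrite mxPzeroD mxPzero_cyclic_sol mxPzero_id.
have Bd' : mxPzero B' = B' by rewrite mxPzeroD mxPzero_cyclic_sol mxPzero_id.
rewrite (mxpair_cayley q0 q_inf Bd Bd' BE BE') -/(reduced_form q X1 X2 B Y1 Y2 B').
have -> : reduced_form q X1 X2 B Y1 Y2 B' =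
    reduced_form q E1 E2 (cyclic_sol q u be X) F1 F2 (cyclic_sol q u be' Y).
  rewrite X1E X2E reduced_formDl.
  rewrite [X in _ + X](reduced_form_strictly_lower q0 laP Wl Bd' BE') addr0.
  rewrite Y1E Y2E reduced_formDr [X in _ + X]reduced_form_skew.
  have El : is_lower (E1 - E2).
    by rewrite /E1 /E2 (canonical_grad_sub u q0 Xc); exact: is_lower_row_col.
  have EBd := mxPzero_cyclic_sol q u be X.
  rewrite [reduced_form q K1 _ _ _ _ _](reduced_form_strictly_lower q0 muP El EBd EE).
  by rewrite oppr0 addr0.
rewrite (reduced_form_canonical q0 Xc Yc beE beE') mulrA mulVf ?mul1r//.
Qed.

End Main.

Lemma expz_neq1 (C : numFieldType) (q : C) (k : int) :
  0 < `|q| < 1 -> k != 0 -> q ^ k != 1.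
Proof.
move=> /andP[q_gt0 q_lt1] k0; apply: contraTneq isT => qk1.
have [m m0 qm1] : exists2 m : nat, (0 < m)%N & q ^+ m = 1.
  case: k k0 qk1 => m m0 qm; [exists m => //; by case: m m0 {qm}|exists m.+1 => //].
  by apply/eqP; rewrite -invr_eq1 -qm.
have := exprn_ilt1 m (normr_ge0 q) q_lt1.
by rewrite -lt0n m0 -normrX qm1 normr1 ltxx.
Qed.

Local Open Scope complex_scope.

Theorem theorem2p13 (R : realType) (q : R[i]) (q01 : 0 < `|q| < 1)
  (n : nat) (n_gt0 : (0 < n)%N)
  (phi psi : 'rV[laurent R[i]]_n -> R[i])
  (phiF : functional_M q phi) (psiF : functional_M q psi)
  (u : 'rV[laurent R[i]]_n) (dphi dpsi : qpdo R[i])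
  (dphiP : is_differential q phi u dphi)
  (dpsiP : is_differential q psi u dpsi) :
  is_qGD_bracket q phi psi u (GD_bracket q u dphi dpsi).
Proof.
have q0 : q != 0 by case/andP: q01; rewrite normr_gt0.
have q_inf (k : int) : k != 0 -> q ^ k != 1 by exact: expz_neq1.
case: n n_gt0 phi psi phiF psiF u dphiP dpsiP => [//|n'] _ phi psi phiF psiF u dphiP dpsiP.
split; [exact: lift_exists|exact: lift_exists|].
move=> f g df dg fl gl dfP dgP.
exact: (S_bracket_lift q0 q_inf fl gl dphiP dpsiP dfP dgP).
Qed.
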